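(* Let $G$ be a non-elementary hyperbolic group, let $W\to G$, $w\mapsto\overline w$, be any choice of generators for $G$, and let $k\ge 1$. Then the following subsets of $W^{(k)}$ are exponentially generic. (1) The set of all $(w_1,\ldots,w_k)\in W^{(k)}$ for which $\overline w_1,\ldots,\overline w_k$ generate a free subgroup of rank $k$ in $G$. (2) For any constant $\varepsilon>0$, the set of all $(w_1,\ldots,w_k)\in W^{(k)}$ for which $\overline w_1,\ldots,\overline w_k$ generate a subgroup with compression factor at least $\frac{1-\theta}{\theta}-\varepsilon$, where $\theta$ is the gross cogrowth of $G$ with respect to the given choice of generators $W\to G$.
   Context: Let $A=\{a_1,\ldots,a_m,a_1^{-1},\ldots,a_m^{-1}\}$ be a finite alphabet with formal inverses, $m\ge 2$ (so $A$ has $2m$ letters). $W$ is the free monoid of all words over $A$ (not necessarily freely reduced); $|w|$ is the length of a word $w$; formal inverses $w^{-1}$ of words are defined in the obvious way. $W_n=\{w\in W: |w|\le n\}$. For $k\ge1$, $W^{(k)}=\{(w_1,\ldots,w_k): w_i\in W\}$ and $W^{(k)}_n=\{(w_1,\ldots,w_k)\in W^{(k)}: |w_i|\le n \text{ for all } i\}$. A subset $X\subset W^{(k)}$ is exponentially generic if there is $\alpha\in(0,1)$ with $\left|1-\frac{|X\cap W^{(k)}_n|}{|W^{(k)}_n|}\right|\le\alpha^n$ for all sufficiently large $n$. A choice of generators for a group $G$ is a monoid epimorphism $W\to G$ respecting inverses; the image of $w$ is denoted $\overline w$. For $g\in G$, $|g|_G$ is the length of a shortest word in $W$ representing $g$.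 A group is elementary if it contains a cyclic subgroup of finite index. $G$ is hyperbolic if its Cayley graph is a $\delta$-hyperbolic geodesic metric space for some $\delta$ (each side of any geodesic triangle lies in the union of the closed $\delta$-neighborhoods of the other two sides). Gross cogrowth: $\theta=\lim_{n\to\infty}\frac1{2n}\log_{2m}|V_{2n}|$, where $V_r$ is the set of all words of length $r$ in $W$ which represent the identity of $G$. Compression factor: if $H\le G$ is a subgroup with finite generating set $B$ closed under inverses, the compression factor of $H$ in $G$ is $\mathrm{Comp}(G,A;H,B)=\inf_{h\in H\setminus\{1\}}\frac{|h|_G}{|h|_H}$, where $|h|_H=\min(|b_{i_1}|_G+\cdots+|b_{i_s}|_G)$, the minimum being over all representations $h=b_{i_1}\cdots b_{i_s}$ with all $b_{i_j}\in B$. For the subgroup generated by $\overline w_1,\ldots,\overline w_k$ the compression factor is taken with respect to $B=\{\overline w_1^{\pm1},\ldots,\overline w_k^{\pm1}\}$. *)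

(* Defs.v *)
From HB Require Import structures.
From mathcomp Require Import all_boot all_order all_algebra finmap.
From mathcomp Require Import all_classical all_reals all_analysis.

Set Implicit Arguments.
Unset Strict Implicit.
Unset Printing Implicit Defensive.

Import Order.TTheory GRing.Theory Num.Theory.
Import numFieldNormedType.Exports.

Local Open Scope classical_set_scope.
Local Open Scope ring_scope.

(* The letter (i, false) stands for a_i and (i, true) for a_i^-1. *)
Notation letter m := ('I_m * bool)%type.
Definition letter_inv m (a : letter m) : letter m := (a.1, ~~ a.2).

Notation word m := (seq (letter m)).
Definition word_inv m (w : word m) : word m := rev (map (@letter_inv m) w).

Definition reduced m (w : word m) : bool :=
  sorted (fun a b => b != letter_inv a) w.

Record generators (m : nat) (G : groupType) := Generators {
  word_val :> word m -> G;
  word_val_nil : word_val [::] = 1%g;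
  word_val_cat : forall u v, word_val (u ++ v) = (word_val u * word_val v)%g;
  word_val_inv : forall w, word_val (word_inv w) = ((word_val w)^-1)%g;
  word_val_surj : forall g, exists w, word_val w = g }.

(* The junk value for the empty set is 0. *)
Definition nat_min (A : set nat) : nat :=
  xget 0%N [set n | A n /\ forall p, A p -> (n <= p)%N].

Lemma nat_minP (A : set nat) :
  A !=set0 -> A (nat_min A) /\ forall p, A p -> (nat_min A <= p)%N.
Proof.
move=> [a Aa]; rewrite /nat_min; case: xgetP => [n -> //|noA].
have exA : exists n, `[< A n >] by exists a; apply/asboolP.
case: (ex_minnP exA) => n /asboolP An minn; case: (noA n); split => // p Ap.
by apply: minn; apply/asboolP.
Qed.

Definition word_length m (G : groupType) (phi : generators m G) (g : G) : nat :=
  nat_min [set size w | w in [set w : word m | phi w = g]].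

Definition vertex_dist m (G : groupType) (phi : generators m G) (g h : G) : nat :=
  word_length phi (g^-1 * h)%g.

Section WordLength.
Variables (m : nat) (G : groupType) (phi : generators m G).

Lemma word_length_le w : (word_length phi (phi w) <= size w)%N.
Proof.
have ne : [set size u | u in [set u : word m | phi u = phi w]] !=set0.
  by exists (size w), w.
by have [_ minL] := nat_minP ne; apply: minL; exists w.
Qed.

Lemma word_length_ex g : exists2 w, phi w = g & size w = word_length phi g.
Proof.
have [w pw] := word_val_surj phi g.
have ne : [set size u | u in [set u : word m | phi u = g]] !=set0.
  by exists (size w), w.
by have [[u pu su] _] := nat_minP ne; exists u.
Qed.

Lemma word_length1 : word_length phi 1%g = 0%N.
Proof.
by apply/eqP; rewrite -leqn0 -(word_val_nil phi) word_length_le.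
Qed.

Lemma word_length_eq0 g : word_length phi g = 0%N -> g = 1%g.
Proof.
have [w <- <-] := word_length_ex g.
by move/size0nil => ->; rewrite word_val_nil.
Qed.

Lemma word_lengthM g h :
  (word_length phi (g * h)%g <= word_length phi g + word_length phi h)%N.
Proof.
have [u pu <-] := word_length_ex g; have [v pv <-] := word_length_ex h.
by rewrite -pu -pv -word_val_cat -size_cat word_length_le.
Qed.

Lemma word_lengthV g : word_length phi (g^-1)%g = word_length phi g.
Proof.
have le x : (word_length phi (x^-1)%g <= word_length phi x)%N.
  have [u pu <-] := word_length_ex x; rewrite -pu -word_val_inv.
  by rewrite (leq_trans (word_length_le _))// size_rev size_map.
by apply/eqP; rewrite eqn_leq le -{1}(invgK g) le.
Qed.

Lemma vertex_distxx g : vertex_dist phi g g = 0%N.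
Proof. by rewrite /vertex_dist mulVg word_length1. Qed.

Lemma vertex_distC g h : vertex_dist phi g h = vertex_dist phi h g.
Proof. by rewrite /vertex_dist -word_lengthV invgM invgK. Qed.

Lemma vertex_dist_triangle h g k :
  (vertex_dist phi g k <= vertex_dist phi g h + vertex_dist phi h k)%N.
Proof.
rewrite /vertex_dist (_ : g^-1 * k = (g^-1 * h) * (h^-1 * k))%g.
  exact: word_lengthM.
by rewrite -mulgA mulVKg.
Qed.

Lemma vertex_dist_eq0 g h : vertex_dist phi g h = 0%N -> g = h.
Proof.
move/word_length_eq0 => e; apply/esym.
by rewrite -[h](mulVKg g) e mulg1.
Qed.

Lemma vertex_dist_edge g i : (vertex_dist phi g (g * phi [:: i])%g <= 1)%N.
Proof. by rewrite /vertex_dist mulKg word_length_le. Qed.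

End WordLength.

(* The geometric realization of the Cayley graph, in which every edge is
   isometric to the unit interval.  There is one edge from g to g * a_i for each
   pair (g, i): the edge labelled a_i^-1 from g * a_i to g is the same edge
   traversed backwards.  [Inner g i t] is the point of that edge at distance t
   from g. *)
Inductive cayley (R : realType) m (G : groupType) (phi : generators m G) :=
| Vertex (g : G)
| Inner (g : G) (i : 'I_m) (t : R) of 0 < t < 1.

Arguments Vertex {R m G phi} g.
Arguments Inner {R m G phi} g i {t} _.

HB.instance Definition _ R m G phi :=
  gen_eqMixin (@cayley R m G phi).
HB.instance Definition _ R m G phi :=
  gen_choiceMixin (@cayley R m G phi).

Section CayleyDistance.
Variables (R : realType) (m : nat) (G : groupType) (phi : generators m G).
Implicit Types (p q : cayley R phi) (e f : bool).

(* The two ends of the edge carrying p, each with the distance from p to it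
   along that edge; at a vertex both ends are the vertex itself. *)
Definition edge_end p e : G * R :=
  match p with
  | Vertex g => (g, 0)
  | @Inner _ _ _ _ g i t _ => if e then ((g * phi [:: (i, false)])%g, 1 - t)
                              else (g, t)
  end.

Definition route p q e f : R :=
  (edge_end p e).2
  + (vertex_dist phi (edge_end p e).1 (edge_end q f).1)%:R
  + (edge_end q f).2.

Definition via_ends p q : R :=
  Num.min (Num.min (route p q false false) (route p q false true))
          (Num.min (route p q true false) (route p q true true)).

(* The path metric: a shortest path either stays inside one edge or passes
   through an end of the edge of p and an end of the edge of q. *)
Definition cayley_dist p q : R :=
  match p, q with
  | @Inner _ _ _ _ g i t _, @Inner _ _ _ _ h j s _ =>
      if (g, i) == (h, j) then Num.min `|t - s| (via_ends p q)
      else via_ends p q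
  | _, _ => via_ends p q
  end.

Let via_le p q e f : via_ends p q <= route p q e f.
Proof.
rewrite /via_ends !ge_min.
by case: e; case: f; rewrite lexx ?orbT.
Qed.

Let dist_le_route p q e f : cayley_dist p q <= route p q e f.
Proof.
have := via_le p q e f.
case: p => [g|g i t ht]; case: q => [h|h j s hs] //=.
by case: ifP => // _ le; rewrite ge_min le orbT.
Qed.

Let dist_le_local g i t ht s hs :
  cayley_dist (@Inner R m G phi g i t ht) (@Inner R m G phi g i s hs)
    <= `|t - s|.
Proof. by rewrite /= eqxx ge_min lexx. Qed.

Let viaP p q : exists e f, via_ends p q = route p q e f.
Proof.
rewrite /via_ends minEle; case: ifP => _; rewrite minEle; case: ifP => _.
- by exists false, false.
- by exists false, true.
- by exists true, false.
- by exists true, true.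
Qed.

Let distP p q : (exists e f, cayley_dist p q = route p q e f) \/
  exists g i t ht s hs, [/\ p = @Inner R m G phi g i t ht,
    q = @Inner R m G phi g i s hs & cayley_dist p q = `|t - s|].
Proof.
have := viaP p q.
case: p => [g|g i t ht]; case: q => [h|h j s hs] /=; try by left.
case: eqP => [[<- <-]|_]; last by left.
rewrite minEle; case: ifP => _; last by left.
by right; exists g, i, t, ht, s, hs.
Qed.

Let end_ge0 p e : 0 <= (edge_end p e).2.
Proof.
case: p => [g|g i t /andP[/ltW t0 /ltW t1]] //=.
by case: e => //=; rewrite subr_ge0.
Qed.

Let route_ge0 p q e f : 0 <= route p q e f.
Proof. by rewrite /route !addr_ge0 ?end_ge0. Qed.

Let routeC p q e f : route p q e f = route q p f e.
Proof. by rewrite /route vertex_distC -addrA addrC [X in X + _]addrC. Qed.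

Let ends_le p e f :
  (vertex_dist phi (edge_end p e).1 (edge_end p f).1)%:R
    <= (edge_end p e).2 + (edge_end p f).2.
Proof.
case: (eqVneq e f) => [->|]; first by rewrite vertex_distxx addr_ge0 ?end_ge0.
case: p => [g|g i t ht] /=; first by rewrite vertex_distxx addr0.
by case: e; case: f => // _ /=; rewrite ?(addrC t) subrK lern1;
  rewrite 1?(vertex_distC phi (g * _)%g) vertex_dist_edge.
Qed.

Let dist_ge0 p q : 0 <= cayley_dist p q.
Proof.
by case: (distP p q) => [[e [f ->]]|[g [i [t [ht [s [hs [_ _ ->]]]]]]]].
Qed.

Lemma cayley_distxx p : cayley_dist p p = 0.
Proof.
apply/eqP; rewrite eq_le dist_ge0 andbT.
case: p => [g|g i t ht].
  apply: (le_trans (dist_le_route _ _ false false)).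
  by rewrite /route /= vertex_distxx !addr0.
by apply: (le_trans (dist_le_local _ _ _ _)); rewrite subrr normr0.
Qed.

Lemma cayley_dist_eq0 p q : cayley_dist p q = 0 -> p = q.
Proof.
case: (distP p q) => [[e [f ->]]|[g [i [t [ht [s [hs [-> -> ->]]]]]]]]; last first.
  move/normr0_eq0/eqP; rewrite subr_eq0 => /eqP ts.
  by move: hs; rewrite -ts => hs; rewrite (bool_irrelevance ht hs).
have inner g i t ht b : 0 < (edge_end (@Inner R m G phi g i t ht) b).2.
  by case/andP: (ht) => t0 t1; case: b => //=; rewrite subr_gt0.
rewrite /route => /eqP.
rewrite paddr_eq0 ?addr_ge0 ?end_ge0// paddr_eq0 ?end_ge0// pnatr_eq0 => /andP[/andP[]].
case: p => [g|g i t ht]; last by rewrite gt_eqF.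
case: q => [h|h j s hs]; last by rewrite (gt_eqF (inner _ _ _ _ _)).
by move=> _ /eqP/vertex_dist_eq0 /= ->.
Qed.

Lemma cayley_distC p q : cayley_dist p q = cayley_dist q p.
Proof.
have le x y : cayley_dist x y <= cayley_dist y x.
  case: (distP y x) => [[e [f ->]]|[g [i [t [ht [s [hs [-> -> ->]]]]]]]].
    by rewrite routeC.
  by rewrite distrC.
by apply/eqP; rewrite eq_le !le.
Qed.

Let route_triangle y p q e f e' f' :
  route p q e f' <= route p y e f + route y q e' f'.
Proof.
set u := edge_end p e; set v := edge_end q f'.
rewrite /route -/u -/v.
set a := edge_end y f; set b := edge_end y e'.
have le1 : (vertex_dist phi u.1 v.1)%:R <= (vertex_dist phi u.1 a.1)%:R
    + ((vertex_dist phi a.1 b.1)%:R + (vertex_dist phi b.1 v.1)%:R) :> R.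
  rewrite -!natrD ler_nat (leq_trans (vertex_dist_triangle phi a.1 _ _))//.
  by rewrite leq_add2l vertex_dist_triangle.
have := ends_le y f e'; rewrite -/a -/b => le2.
rewrite -!addrA lerD2l (le_trans (lerD le1 (lexx v.2)))//.
rewrite -!addrA lerD2l [leRHS]addrA [leRHS]addrA -[leRHS]addrA.
by rewrite lerD2r.
Qed.

Let local_route g i t ht s hs q e f :
  route (@Inner R m G phi g i t ht) q e f
    <= `|t - s| + route (@Inner R m G phi g i s hs) q e f.
Proof.
rewrite /route (_ : (edge_end (@Inner R m G phi g i t ht) e).1
  = (edge_end (@Inner R m G phi g i s hs) e).1); last by case: e.
rewrite !addrA !lerD2r; case: e => /=.
  by rewrite addrA lerBrDr -addrA addrC lerD2r addrC distrC ler_norm.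
by rewrite -lerBlDr ler_norm.
Qed.

Lemma cayley_dist_triangle y p q :
  cayley_dist p q <= cayley_dist p y + cayley_dist y q.
Proof.
case: (distP p y) => [[e [f py]]|[g [i [t [ht [s [hs [-> yE ->]]]]]]]].
  case: (distP y q) => [[e' [f' ->]]|[g [i [t [ht [s [hs [yE -> ->]]]]]]]].
    by rewrite py (le_trans (dist_le_route _ _ e f'))// route_triangle.
  rewrite py (le_trans (dist_le_route _ _ e f))// yE.
  rewrite [leLHS]routeC [X in X + _]routeC addrC distrC.
  exact: local_route.
case: (distP y q) => [[e' [f' ->]]|[h [j [t' [ht' [r [hr [yE' -> ->]]]]]]]].
  by rewrite yE (le_trans (dist_le_route _ _ e' f'))// local_route.
move: yE' hr; rewrite yE => -[<- <- <-] hr.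
by rewrite (le_trans (dist_le_local _ _ _ _))// ler_distD.
Qed.

HB.instance Definition _ := isMetric.Build R (cayley R phi)
  cayley_distxx cayley_dist_eq0 cayley_distC cayley_dist_triangle.

End CayleyDistance.

(* S is the image of a geodesic from x to y. *)
Definition geodesic (R : realType) (X : metricType R) (x y : X) (S : set X) :=
  exists (l : R) (c : R -> X),
    [/\ 0 <= l, c 0 = x, c l = y,
        {in `[0, l] &, forall s t, mdist (c s) (c t) = `|s - t|}
      & S = c @` `[0, l]].

(* For unions of geodesics, which are compact, this is the set of points at
   distance at most delta from S. *)
Definition closed_nbhd (R : realType) (X : metricType R) (delta : R)
    (S : set X) : set X :=
  [set p | exists2 q, S q & mdist p q <= delta].

Definition geodesic_space (R : realType) (X : metricType R) :=
  forall x y : X, exists S, geodesic x y S.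

Definition thin_triangles (R : realType) (delta : R) (X : metricType R) :=
  forall (x y z : X) (S1 S2 S3 : set X),
    geodesic x y S1 -> geodesic y z S2 -> geodesic z x S3 ->
    [/\ S1 `<=` closed_nbhd delta (S2 `|` S3),
        S2 `<=` closed_nbhd delta (S3 `|` S1)
      & S3 `<=` closed_nbhd delta (S1 `|` S2)].

(* Hyperbolicity is a property of the group alone: it asks for some choice of
   generators, possibly on another alphabet, with hyperbolic Cayley graph. *)
Definition hyperbolic_group (R : realType) (G : groupType) :=
  exists (m : nat) (psi : generators m G) (delta : R),
    geodesic_space (cayley R psi) /\ thin_triangles delta (cayley R psi).

Section Subgroups.
Variable G : groupType.
Implicit Types (B H : set G).

Definition subgroup H :=
  [/\ H 1%g, forall x y, H x -> H y -> H (x * y)%g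
    & forall x, H x -> H (x^-1)%g].

Definition generated B : set G := smallest subgroup B.

Definition finite_index H :=
  finite_set (range (fun g : G => [set (g * h)%g | h in H])).

Definition elementary := exists c : G, finite_index (generated [set c]).

Definition basis_val k (b : 'I_k -> G) (w : word k) : G :=
  (\prod_(a <- w) if a.2 then (b a.1)^-1 else b a.1)%g.

Definition free_basis k H (b : 'I_k -> G) :=
  generated (range b) = H /\
  forall w : word k, reduced w -> w <> [::] -> basis_val b w <> 1%g.

Definition free_of_rank k H := exists b : 'I_k -> G, free_basis H b.

End Subgroups.

Section Compression.
Variables (R : realType) (m : nat) (G : groupType) (phi : generators m G).

Definition sub_length (B : set G) (h : G) : nat :=
  nat_min [set (\sum_(b <- s) word_length phi b)%N | s in
    [set s : seq G | (forall b, b \in s -> B b) /\ (\prod_(b <- s) b)%g = h]].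

(* The infimum is +oo when H is trivial. *)
Definition compression (H B : set G) : \bar R :=
  ereal_inf [set ((word_length phi h)%:R / (sub_length B h)%:R)%:E |
    h in H `\` [set 1%g]].

Definition identity_words (r : nat) : nat :=
  #|[pred w : r.-tuple (letter m) | phi w == 1%g]|.

Definition gross_cogrowth : R :=
  limn (fun n => (n.*2)%:R^-1 *
    (ln (identity_words n.*2)%:R / ln (m.*2)%:R) : R).

Definition images k (w : k.-tuple (word m)) : set G :=
  range (fun i : 'I_k => phi (tnth w i)).

Definition sym_images k (w : k.-tuple (word m)) : set G :=
  images w `|` [set (x^-1)%g | x in images w].

End Compression.

Definition word_ball m k (n : nat) : set (k.-tuple (word m)) :=
  [set w | forall i, (size (tnth w i) <= n)%N].

Lemma finite_word_ball m k n : finite_set (@word_ball m k n).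
Proof.
pose f (t : {ffun 'I_k -> n.-bseq (letter m)}) : k.-tuple (word m) :=
  [tuple (t i : seq (letter m)) | i < k].
apply: (@sub_finite_set _ _ (range f)); last exact/finite_image/finite_finset.
move=> w wn; exists [ffun i => Bseq (wn i)] => //.
by apply: eq_from_tnth => i; rewrite tnth_mktuple ffunE.
Qed.

(* By [finite_word_ball], [fset_set] is not applied to infinite sets here. *)
Definition exp_generic (R : realType) m k (X : set (k.-tuple (word m))) :=
  exists2 alpha : R, 0 < alpha < 1 &
    exists N : nat, forall n, (N <= n)%N ->
      `|1 - #|` fset_set (X `&` word_ball n)|%:R
            / #|` fset_set (@word_ball m k n)|%:R| <= alpha ^+ n.

(* Main.v *)
(* A word [w] of length [n] is a random walk on [G].  Since [G] is hyperbolic and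
   not elementary, it has four elements [g^N], [g^-N], [t g^N t^-1],
   [t g^-N t^-1] pointing in diverging directions; a geometrically decreasing
   function of the word length is strictly superharmonic for them, whence a
   spectral gap: at most [kappa ^ n] words of length [n] represent a given
   element, with [kappa < 2m].  Consequently, outside an exponentially small
   proportion of tuples, the [w_i^{+-1}] have linear length in [G] while their
   mutual Gromov products are small: a path crossing a ball of radius [O(log n)]
   around a given far away point has exponentially small probability.  The
   products of such elements along reduced words are almost geodesic, so they
   freely generate a subgroup of compression factor at least [1 - eps].  This
   suffices because [theta >= 1/2], as [u u^-1] represents 1 for each word [u].

   Gromov products are kept doubled, so that most distances stay in [nat]. *)
Require Import Defs.
From mathcomp Require Import all_boot all_order all_algebra finmap.
From mathcomp Require Import all_classical all_reals all_analysis.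
From mathcomp Require Import zify ring lra.

Set Implicit Arguments.
Unset Strict Implicit.
Unset Printing Implicit Defensive.

Import Order.TTheory GRing.Theory Num.Theory.
Import numFieldNormedType.Exports.

Local Open Scope classical_set_scope.
Local Open Scope ring_scope.

(** * Thin triangles and the four-point condition *)

(** Hyperbolicity is given for some generators [psi], on an alphabet unrelated to the one on which
    the words are written. The thin geometry therefore lives in the word metric of [psi], where
    words over the alphabet of [phi] are seen as paths with bounded steps. Lengths must finally be
    compared in the metric of [phi]. A bi-Lipschitz change of metric does not control Gromov
    products, which are differences of distances; the Morse lemma does. No explicit value of [kappa]
    is available, so the other constants are chosen after it. Put [tau = kappa / 2m]. A ball of
    radius [e = O(log n)] has at most [Q ^ e] elements, a polynomial in [n], so hitting it after
    linearly many letters stays exponentially rare. Gromov products are cut off at [rho = n / T].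
    For [T] large, even the event that a word has length at most a prescribed multiple of [rho] is
    exponentially rare, since [Q ^ O(n / T)] is beaten by [tau ^ (n / 2)]. The ratio of the
    cancellation to the lengths can thus be made as small as desired, which brings the compression
    factor close to 1. *)

Section ThinTriangles.
Variables (R : realType) (X : metricType R) (delta : R).
Hypothesis Xgeo : geodesic_space X.
Hypothesis Xthin : thin_triangles delta X.
Implicit Types (x y z w p : X) (S : set X).

Lemma geodesic_mid x y S p :
  geodesic x y S -> S p -> mdist x p + mdist p y = mdist x y.
Proof.
move=> [l [c [l0 <- <- ic ->]]] [t /= tl <-].
have t0 : (0 : R) \in `[0, l] by rewrite in_itv /= lexx.
have ll : l \in `[0, l] by rewrite in_itv /= lexx l0.
rewrite !ic //; move: tl; rewrite in_itv /= => /andP[h0 hl].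
by rewrite !sub0r !normrN (ger0_norm h0) (ger0_norm l0) distrC ger0_norm ?subr_ge0//; lra.
Qed.

Lemma geodesic_left x y S : geodesic x y S -> S x.
Proof.
by move=> [l [c [l0 <- _ _ ->]]]; exists 0 => //=; rewrite in_itv /= lexx.
Qed.

Lemma geodesic_right x y S : geodesic x y S -> S y.
Proof.
by move=> [l [c [l0 _ <- _ ->]]]; exists l => //=; rewrite in_itv /= lexx l0.
Qed.

Lemma thin_delta_ge0 x : 0 <= delta.
Proof.
have [S gS] := Xgeo x x.
have [_ _ S3] := Xthin gS gS gS.
by have [q _] := S3 _ (geodesic_left gS); apply: le_trans; exact: mdist_ge0.
Qed.

(* The side [z, x] is covered by the neighbourhoods of the two other sides;
   scanning it by steps of length 1 finds a point close to both. *)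
Lemma gromov_product_ge z x w S : geodesic z x S ->
  exists2 p, S p &
    2 * mdist w p <= mdist z w + mdist x w - mdist z x + (4 * delta + 2).
Proof.
move=> gS; have d0 := thin_delta_ge0 z.
have [A gA] := Xgeo x w; have [B gB] := Xgeo w z.
have [cov _ _] := Xthin gS gA gB.
suff [p Sp [a [b [Aa Bb pa pb]]]] : exists2 p, S p & exists a b,
    [/\ A a, B b, mdist p a <= delta + 1 & mdist p b <= delta].
  exists p => //.
  have := geodesic_mid gA Aa; have := geodesic_mid gB Bb.
  have := geodesic_mid gS Sp.
  have := metric_triangle w a p; have := metric_triangle x a p.
  have := metric_triangle w b p; have := metric_triangle z b p.
  move: (metric_sym w a) (metric_sym w b) (metric_sym w p) (metric_sym a p).
  move: (metric_sym b p) (metric_sym x a) (metric_sym z b) (metric_sym x p).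
  move: (metric_sym z p) (metric_sym x w) (metric_sym z w) (metric_sym z x).
  by lra.
case: (gS) => l [c [l0 c0 cl ic SE]].
pose u (n : nat) := Num.min n%:R l.
have ul n : u n \in `[0, l].
  by rewrite in_itv /= /u le_min ler0n l0 ge_min lexx orbT.
have Su n : S (c (u n)) by rewrite SE; exists (u n) => //; exact: ul.
have exn : exists n, `[< exists2 a, A a & mdist (c (u n)) a <= delta >].
  exists (Num.bound l); apply/asboolP; exists x; first exact: geodesic_left gA.
  rewrite /u min_r; first by rewrite cl mdistxx.
  exact/ltW/archi_boundP.
(* Take the first index whose point is near [A]. At index 0 the point is [z], which lies on [B].
   Otherwise the preceding point is not near [A], hence near [B] by thinness, and it is at distance
   at most 1 from a point near [A]. *)
case: (ex_minnP exn) => -[|n] /asboolP [a Aa pa] minn.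
  exists (c (u 0%N)) => //; exists a, z; split => //.
  - exact: geodesic_right gB.
  - by rewrite (le_trans pa)// lerDl.
  - by rewrite /u min_l// c0 mdistxx.
exists (c (u n)) => //.
have [|b [Ab|Bb] pb] := cov (c (u n)); first exact: Su.
  have nearA : `[< exists2 a, A a & mdist (c (u n)) a <= delta >].
    by apply/asboolP; exists b.
  by have := minn n nearA; rewrite ltnn.
exists a, b; split => //.
apply: (le_trans (metric_triangle _ (c (u n.+1)) _)).
rewrite addrC lerD// metric_sym ic ?ul//.
by rewrite ler_norml /u -natr1 !minEle; do 2 case: ifP; lra.
Qed.

(** A point [p] of [[z, x]] is about as close to [w] as half of [d z w + d x w - d z x]. Thinness
    moves [p] to a point [q] of [[x, y]] or of [[y, z]], and the side that contains [q] selects the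
    term of the maximum. The constant is [4 * delta + 2] for [p], plus [delta] for each of the two
    uses of [q] in place of [p]. *)
Lemma four_point x y z w :
  mdist x z + mdist y w <=
    Num.max (mdist x y + mdist z w) (mdist x w + mdist y z) + (6 * delta + 2).
Proof.
have [A gA] := Xgeo x y; have [B gB] := Xgeo y z; have [S gS] := Xgeo z x.
have [_ _ cov] := Xthin gA gB gS.
have [p Sp pw] := gromov_product_ge w gS.
have [q [qA|qB] pq] := cov p Sp.
- have := geodesic_mid gA qA.
  move: (metric_triangle x q w) (metric_triangle y q w) (metric_triangle w p q).
  have : mdist x y + mdist z w <=
    Num.max (mdist x y + mdist z w) (mdist x w + mdist y z) by rewrite le_max lexx.
  move: (metric_sym q w) (metric_sym q y) (metric_sym x z).
  by lra.
- have := geodesic_mid gB qB.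
  move: (metric_triangle y q w) (metric_triangle z q w) (metric_triangle w p q).
  have : mdist x w + mdist y z <=
    Num.max (mdist x y + mdist z w) (mdist x w + mdist y z).
    by rewrite le_max lexx orbT.
  move: (metric_sym q w) (metric_sym q z) (metric_sym x z) (metric_sym z w).
  by lra.
Qed.

End ThinTriangles.

(** * Paths and quasi-geodesics in hyperbolic spaces *)

Lemma muln_le_exp2 M k : (M * k <= 2 ^ k + M * M)%N.
Proof.
have [kM|/ltnW Mk] := leqP k M; first by rewrite (leq_trans _ (leq_addl _ _))// leq_mul2l kM orbT.
rewrite -(subnK Mk); elim: (k - M)%N => [|i IH]; first by rewrite leq_addl.
rewrite addSn mulnS expnS; have := ltn_expl (i + M) (isT : 1 < 2)%N; lia.
Qed.

Lemma up_log2_sublinear M : exists C, forall x, (M * up_log 2 x <= x + C)%N.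
Proof.
exists (M + M * M)%N => x; have [x1|x1] := leqP x 1.
  by have -> : up_log 2 x = 0%N; [apply/eqP; rewrite up_log_eq0 x1 orbT | lia].
have := up_log_gtn (isT : 1 < 2)%N x1; have := muln_le_exp2 M (up_log 2 x).-1.
have : (0 < up_log 2 x)%N by rewrite up_log_gt0.
by case: (up_log 2 x) => //= k _; rewrite mulnS; lia.
Qed.

Section HyperbolicPaths.
Variables (T : Type) (d : T -> T -> nat) (D : nat).
Hypothesis dxx : forall x, d x x = 0%N.
Hypothesis dC : forall x y, d x y = d y x.
Hypothesis dtri : forall x y z, (d x z <= d x y + d y z)%N.
Hypothesis geod : forall x y i, (i <= d x y)%N ->
  exists z, d x z = i /\ d z y = (d x y - i)%N.
Hypothesis four : forall x y z w,
  (d x z + d y w <= maxn (d x y + d z w) (d x w + d y z) + D)%N.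

(* Halving the path costs [D] in the Gromov product, so a path of length [n]
   passes at distance [O(log n)] from the geodesics between its ends. *)
Lemma path_near (K : nat) (x : nat -> T) y k i n : (n <= 2 ^ k)%N ->
  (forall j, (i <= j < i + n)%N -> (d (x j) (x j.+1) <= K)%N) ->
  exists2 j, (i <= j <= i + n)%N &
   (2 * d y (x j) + d (x i) (x (i + n)) <= d (x i) y + d y (x (i + n)) + k * D + 2 * K)%N.
Proof.
elim: k i n => [|k IH] i n nk step.
  exists i; first by rewrite leqnn leq_addr.
  case: n nk step => [|[|//]] _ step; first by rewrite addn0 dxx (dC y); lia.
  rewrite addn1; have := step i; rewrite leqnn addn1 ltnSn => /(_ isT).
  by have := dtri y (x i.+1) (x i); rewrite (dC y (x i)) (dC (x i.+1)); lia.
have [nk'|/ltnW nk'] := leqP n (2 ^ k).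
  have [j ij le] := IH i n nk' step; exists j => //; lia.
pose m := (2 ^ k)%N; pose n' := (n - m)%N.
have En : n = (m + n')%N by rewrite /n'; lia.
have n'k : (n' <= 2 ^ k)%N by move: nk; rewrite /n' expnS -/m; lia.
have [j hj|j1 ij1 le1] := IH i m (leqnn _); first by apply: step; lia.
have [j hj|j2 ij2 le2] := IH (i + m)%N n' n'k; first by apply: step; lia.
rewrite -addnA -En in le2.
have := four (x i) (x (i + m)%N) (x (i + n)%N) y.
move: le1 le2; rewrite mulSn !(dC _ y) => le1 le2; rewrite /maxn; case: ifP => _ h4.
  by exists j2; lia.
by exists j1; lia.
Qed.

(** Among the points with defect at most [r], let [y] be at the largest distance [m] from the path.
    Going [s] away from [y] towards both ends gives points of defect at most [r], hence [m]-close to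
    path points [x i1] and [x i2]. These have bounded Gromov product at [y], and the path between
    them has length [O(m + r)], so by [path_near] it comes within [O(log (m + r) + r)] of [y]. It
    stays at distance at least [m] from [y], which bounds [m]. *)
Lemma morse K L : exists C, forall (x : nat -> T) n y r,
  (forall j, (j < n)%N -> (d (x j) (x j.+1) <= K)%N) ->
  (forall i j, (i <= j <= n)%N -> (j - i <= L * d (x i) (x j))%N) ->
  (d (x 0%N) y + d y (x n) <= d (x 0%N) (x n) + r)%N ->
  exists2 i, (i <= n)%N & (d y (x i) <= 2 * r + C)%N.
Proof.
(* The piece of path has length at most [L * (2 * m + 2 * s)], and [2 * m + 2 * s] contains [6 * m].
   This factor makes [D] times its logarithm at most [m] plus lower terms, to be compared with
   [2 * m]. *)
have [C0 logC] := up_log2_sublinear (6 * L * D)%N.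
exists (4 * D + 2 * K + C0 + 10)%N => x n y0 r step qgeo y0r.
pose E y := (d (x 0%N) y + d y (x n) <= d (x 0%N) (x n) + r)%N.
pose far m := `[< exists2 y, E y & forall i, (i <= n)%N -> (m <= d y (x i))%N >].
have exfar : exists m, far m by exists 0%N; apply/asboolP; exists y0.
have ubfar m : far m -> (m <= d (x 0%N) (x n) + r)%N.
  by case/asboolP => y Ey /(_ 0%N isT); move: Ey; rewrite /E (dC y (x 0%N)); lia.
case: (ex_maxnP exfar ubfar) => m /asboolP[y Ey ym] maxm.
have near z : E z -> exists2 i, (i <= n)%N & (d z (x i) <= m)%N.
  move=> Ez; apply: contrapT => nex.
  have : far m.+1.
    apply/asboolP; exists z => // i ni; rewrite ltnNge; apply/negP => le.
    by apply: nex; exists i.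
  by move/maxm; rewrite ltnn.
suff mC : (m <= 2 * r + (4 * D + 2 * K + C0 + 10))%N.
  by have [i ni le] := near y0 y0r; exists i => //; apply: leq_trans mC.
have sub i j : (i <= n)%N -> (j <= n)%N -> exists2 l, (l <= n)%N &
    (2 * d y (x l) + d (x i) (x j) <= d (x i) y + d y (x j)
      + D * up_log 2 (L * d (x i) (x j)) + 2 * K)%N.
  wlog ij : i j / (i <= j)%N => [hw|] ni nj.
    have [/hw|/ltnW/hw] := leqP i j; first exact.
    case=> // l nl; rewrite (dC (x j)) (dC (x j) y) (dC y (x i)) => le.
    by exists l => //; lia.
  have [||l ijl] := @path_near K x y (up_log 2 (j - i)) i (j - i).
  - exact: up_logP.
  - by move=> l il; apply: step; lia.
  rewrite subnKC// => le; exists l; first lia.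
  apply: (leq_trans le); rewrite leq_add2r leq_add2l mulnC leq_mul2l leq_up_log ?orbT//.
  by apply: qgeo; rewrite ij.
(* With this [s], replacing [z1] and [z2] by path points at distance at most [m] costs only [D] each
   in the doubled Gromov product at [y]: the other branch of the four-point condition would give
   [s <= 2 * m + r + D]. An end closer to [y] than [s] is itself a path point. *)
have [s sE] : exists s, s = (2 * m + r + D + 1)%N by eexists.
have side e : (e = x 0%N \/ e = x n) -> exists z i, [/\ (i <= n)%N,
    (d e z + d z y = d e y)%N, (d z y <= s)%N, (d z (x i) <= m)%N
    & x i = z \/ d z y = s].
  move=> eE; have [es|se] := leqP (d e y) s.
    case: eE => eE; [exists e, 0%N | exists e, n]; rewrite eE dxx -eE; split => //; by left.
  have sy : (s <= d y e)%N by rewrite dC ltnW.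
  have [z []] := geod sy.
  rewrite !(dC y) => zs ze.
  have Ez : E z.
    move: Ey sy zs ze (dtri z y (x n)) (dtri (x 0%N) y z); rewrite /E.
    by case: eE => ->; rewrite !(dC _ z) !(dC _ y); lia.
  have [i ni zi] := near z Ez; exists z, i; split => //; [|by rewrite zs|by right].
  by rewrite (dC e z); lia.
have [z1 [i1 [n1 e1 s1 m1 c1]]] := side (x 0%N) (or_introl erefl).
have [z2 [i2 [n2 e2 s2 m2 c2]]] := side (x n) (or_intror erefl).
have Gz : (d z1 y + d z2 y <= d z1 z2 + r)%N.
  move: Ey; rewrite /E; have := dtri (x 0%N) z1 (x n); have := dtri z1 z2 (x n).
  by rewrite (dC y (x n)) (dC z2 (x n)); lia.
have G1 : (d (x i1) y + d z2 y <= d (x i1) z2 + r + D)%N.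
  case: c1 => [->|zs]; first by lia.
  have := four z1 (x i1) z2 y; have := dtri z1 (x i1) y.
  have := dtri (x i1) z1 z2; rewrite (dC (x i1) z1).
  rewrite /maxn; case: ifP; lia.
have G2 : (d (x i1) y + d (x i2) y <= d (x i1) (x i2) + r + 2 * D)%N.
  case: c2 => [->|zs]; first by lia.
  have := four (x i1) (x i2) z2 y; have := dtri z2 (x i2) y.
  rewrite (dC (x i2) z2) /maxn; case: ifP; lia.
have [l nl] := sub i1 i2 n1 n2.
have dl : (d (x i1) (x i2) <= 2 * m + 2 * s)%N.
  have := dtri (x i1) z1 (x i2); have := dtri z1 z2 (x i2).
  have := dtri z1 y z2; rewrite (dC (x i1) z1) (dC y z2); lia.
have := ym l nl; rewrite (dC y (x i2)).
have := logC (L * d (x i1) (x i2))%N.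
set u := up_log 2 _ => hu h1 h2.
have {}hu : (D * u <= m + r + D + C0 + 2)%N.
  case: (posnP L) hu => [L0|L0] hu.
    by rewrite /u L0 mul0n up_log0 muln0.
  have : (6 * L * (D * u) <= 6 * L * (m + r + D + C0 + 2))%N.
    rewrite mulnA (leq_trans hu)//.
    have : (L * d (x i1) (x i2) <= L * (2 * m + 2 * s))%N by rewrite leq_mul2l dl orbT.
    have : (C0 <= L * C0)%N by rewrite leq_pmull.
    rewrite sE; move: (L) L0 => l' l0.
    nia.
  by rewrite leq_pmul2l// muln_gt0.
lia.
Qed.

End HyperbolicPaths.

(** * Loxodromic elements *)

Definition four_point_bound (D : nat) m (G : groupType) (psi : generators m G) :=
  forall x y z w, (vertex_dist psi x z + vertex_dist psi y w <=
    maxn (vertex_dist psi x y + vertex_dist psi z w)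
         (vertex_dist psi x w + vertex_dist psi y z) + D)%N.

Section WordMetric.
Variables (m : nat) (G : groupType) (psi : generators m G).
Local Notation wl := (word_length psi).
Local Notation vd := (vertex_dist psi).
Implicit Types x y g h t : G.

Lemma vertex_distMl t x y : vd (t * x)%g (t * y)%g = vd x y.
Proof. by rewrite /vertex_dist invgM mulgA mulgVK. Qed.

Lemma vertex_dist1l x : vd 1%g x = wl x.
Proof. by rewrite /vertex_dist invg1 mul1g. Qed.

Lemma vertex_distMr x y : vd x (x * y)%g = wl y.
Proof. by rewrite /vertex_dist mulKg. Qed.

Lemma vertex_dist_geodesic x y i : (i <= vd x y)%N ->
  exists z, vd x z = i /\ vd z y = (vd x y - i)%N.
Proof.
rewrite [vd x y]/vertex_dist => ile.
have [w pw sw] := word_length_ex psi (x^-1 * y)%g.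
have E : (psi (take i w) * psi (drop i w))%g = (x^-1 * y)%g.
  by rewrite -word_val_cat cat_take_drop.
have le1 : (vd x (x * psi (take i w))%g <= i)%N.
  rewrite vertex_distMr (leq_trans (word_length_le _ _))// size_take_min.
  exact: geq_minl.
have le2 : (vd (x * psi (take i w))%g y <= wl (x^-1 * y)%g - i)%N.
  rewrite (_ : y = x * psi (take i w) * psi (drop i w))%g; last first.
    by rewrite -mulgA E mulVKg.
  rewrite vertex_distMr (leq_trans (word_length_le _ _))// size_drop sw.
  by rewrite -!mulgA E mulVKg.
exists (x * psi (take i w))%g.
have := vertex_dist_triangle psi (x * psi (take i w))%g x y.
by rewrite [vd x y]/vertex_dist; lia.
Qed.

Lemma word_ball_enum n : exists s : seq G, forall x, (wl x <= n)%N -> x \in s.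
Proof.
exists [seq psi (val w) | w <- enum {: n.-bseq (letter m)}] => x xn.
have [w pw sw] := word_length_ex psi x.
have wn : (size w <= n)%N by rewrite sw.
by apply/mapP; exists (Bseq wn); rewrite ?mem_enum.
Qed.

Lemma word_length_expg g n : (wl (g ^+ n)%g <= n * wl g)%N.
Proof.
elim: n => [|n IH]; first by rewrite expg0 word_length1.
by rewrite expgS mulSn (leq_trans (word_lengthM _ _ _))// leq_add2l.
Qed.

Lemma word_length_conj t g : (wl (t * g * t^-1)%g <= wl g + 2 * wl t)%N.
Proof.
have := word_lengthM psi (t * g)%g (t^-1)%g; have := word_lengthM psi t g.
by rewrite word_lengthV; lia.
Qed.

Lemma word_length_conj_ge t g : (wl g <= wl (t * g * t^-1)%g + 2 * wl t)%N.
Proof.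
have := word_length_conj (t^-1)%g (t * g * t^-1)%g.
by rewrite invgK !mulgA mulVg mul1g mulgVK word_lengthV.
Qed.

Lemma subgroup_generated (B : set G) : subgroup (generated B).
Proof.
split=> [H [[]]//|x y Hx Hy H [sH BH]|x Hx H [sH BH]].
- by case: (sH) => _ + _; apply; [apply: Hx|apply: Hy].
- by case: (sH) => _ _; apply; apply: Hx.
Qed.

Lemma generated_sub (B : set G) x : B x -> generated B x.
Proof. by move=> Bx H [_]; apply. Qed.

Lemma generated_expg (B : set G) x n : generated B x -> generated B (x ^+ n)%g.
Proof.
have [g1 gM gV] := subgroup_generated B => Bx.
by elim: n => [|n IH]; [rewrite expg0 | rewrite expgS; apply: gM].
Qed.

(** Each coset [x H] meets the ball of radius [C], in [x * h] for an [h] of [H] close to [x^-1], and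
    this ball is finite. *)
Lemma elementary_cobounded g C :
  (forall t, exists2 h, generated [set g] h & (vd t h <= C)%N) -> elementary G.
Proof.
move=> cob; exists g; rewrite /finite_index.
have [s sP] := word_ball_enum C.
set H := generated [set g]; have [H1 HM HV] := subgroup_generated [set g].
apply: (@sub_finite_set _ _ ((fun b => [set (b * h)%g | h in H]) @` [set` s]));
  last exact/finite_image/finite_seq.
move=> _ [x _ <-]; have [h Hh xh] := cob (x^-1)%g.
exists (x * h)%g.
  apply: sP; move: xh.
  by rewrite /vertex_dist invgK.
apply/seteqP; split=> [_ [y Hy <-]|_ [y Hy <-]].
- by exists (h * y)%g; [apply: HM|rewrite mulgA].
- by exists (h^-1 * y)%g; [apply: HM => //; apply: HV|rewrite mulgA mulgK].
Qed.

End WordMetric.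

Section Loxodromic.
Variables (m : nat) (G : groupType) (psi : generators m G) (D : nat).
Local Notation wl := (word_length psi).
Local Notation vd := (vertex_dist psi).
Hypothesis four : four_point_bound D psi.
Implicit Types x y g h t a b : G.

(** A local condition on [g] and [g ^+ 2] which, by the four-point condition, propagates to linear
    growth of all powers. *)
Definition loxodromic g := (wl g + 2 * D < wl (g ^+ 2)%g)%N.

Lemma loxodromicV g : loxodromic g -> loxodromic (g^-1)%g.
Proof. by rewrite /loxodromic expVgn !word_lengthV. Qed.

(** A non-elementary group is infinite, hence contains [z = x * y] with [wl x = wl y = L] and
    [wl z = 2 * L]. Suppose that [x] and [y] have short squares: [x] points in the direction of
    [x^-1], and [y] in that of [y^-1]. Since [x^-1] and [y] diverge, so do [x] and [y], then [x] and
    [y^-1]. Hence there is little cancellation in [y * x], and [z ^+ 2] is long. The second of these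
    steps requires [L > 4 * D]. *)
Lemma loxodromic_exists : ~ elementary G -> exists g, loxodromic g.
Proof.
move=> nel; pose L := (4 * D + 1)%N.
have [z0 z0L] : exists z, (2 * L <= wl z)%N.
  apply: contrapT => nz; apply: nel; apply: (@elementary_cobounded _ _ psi 1%g (2 * L)).
  move=> t; exists 1%g; first by case: (subgroup_generated [set (1%g : G)]).
  rewrite vertex_distC vertex_dist1l leqNgt; apply/negP => tL.
  by apply: nz; exists t; rewrite ltnW.
have [z [z1 _]] := @vertex_dist_geodesic _ _ psi 1%g z0 (2 * L)%N ltac:(by rewrite vertex_dist1l).
rewrite vertex_dist1l in z1.
have [x [x1 x2]] := @vertex_dist_geodesic _ _ psi 1%g z L ltac:(by rewrite vertex_dist1l; lia).
rewrite !vertex_dist1l in x1 x2.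
pose y := (x^-1 * z)%g.
have yL : wl y = L by rewrite /vertex_dist in x2; rewrite x2; lia.
have zE : z = (x * y)%g by rewrite /y mulVKg.
apply: contrapT => nlox.
have nx : (wl (x ^+ 2)%g <= L + 2 * D)%N.
  by rewrite leqNgt; apply/negP => h; apply: nlox; exists x; rewrite /loxodromic x1.
have ny : (wl (y ^+ 2)%g <= L + 2 * D)%N.
  by rewrite leqNgt; apply/negP => h; apply: nlox; exists y; rewrite /loxodromic yL.
apply: nlox; exists z; rewrite /loxodromic z1.
have Vx : wl (x^-1)%g = L by rewrite word_lengthV.
have Vy : wl (y^-1)%g = L by rewrite word_lengthV.
have exV u v : vd (u^-1)%g v = wl (u * v)%g by rewrite /vertex_dist invgK.
have v1 u : vd u 1%g = wl u by rewrite vertex_distC vertex_dist1l.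
have dyy : vd (y^-1)%g y = wl (y ^+ 2)%g by rewrite exV expgS expg1.
have dxx' : vd (x^-1)%g x = wl (x ^+ 2)%g by rewrite exV expgS expg1.
have f1 := four (x^-1)%g x y 1%g.
rewrite dxx' exV -zE z1 !v1 Vx x1 yL in f1.
have {f1}dxy : (2 * L <= vd x y + D)%N by move: f1; rewrite /maxn; case: ifP; rewrite /L; lia.
have f2 := four x (y^-1)%g y 1%g.
rewrite dyy !v1 Vy x1 yL in f2.
have {f2}dyx : (2 * L <= vd x (y^-1)%g + 2 * D)%N.
  by move: f2; rewrite /maxn; case: ifP; rewrite /L in dxy *; lia.
have yxE : wl (y * x)%g = vd x (y^-1)%g by rewrite vertex_distC exV.
have f3 := four 1%g x z (z * x)%g.
have e1 : vd x (z * x)%g = wl (y * x)%g by rewrite zE -mulgA vertex_distMr.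
have e2 : vd x z = L by rewrite zE vertex_distMr.
have e3 : vd z (z * x)%g = L by rewrite vertex_distMr.
rewrite !vertex_dist1l e1 e2 e3 z1 x1 yxE in f3.
have {f3}xyx : (3 * L <= wl (z * x)%g + 3 * D)%N.
  by move: f3; rewrite /maxn; case: ifP; rewrite /L in dyx *; lia.
have f4 := four 1%g z (z * x)%g (z ^+ 2)%g.
have e4 : vd z (z ^+ 2)%g = (2 * L)%N by rewrite expg2 vertex_distMr.
have e5 : vd (z * x)%g (z ^+ 2)%g = L.
  by rewrite expg2 {3}zE mulgA vertex_distMr.
rewrite !vertex_dist1l e3 e4 e5 z1 in f4.
by move: f4; rewrite /maxn; case: ifP; rewrite /L in xyx *; lia.
Qed.

Section Powers.
Variable g : G.
Hypothesis lox : loxodromic g.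

(** By induction each power is longer than the previous one by more than [D], which excludes the
    unwanted branch of the four-point condition for the next power. *)
Lemma loxodromic_step n : (wl (g ^+ n)%g + wl (g ^+ 2)%g <= wl (g ^+ n.+1)%g + wl g + D)%N.
Proof.
have a2 : (wl (g ^+ 2)%g <= wl g + wl g)%N by rewrite expgS expg1 word_lengthM.
elim: n => [|n IH]; first by rewrite expg0 word_length1 expg1; move: lox; rewrite /loxodromic; lia.
have := four 1%g (g ^+ n)%g (g ^+ n.+1)%g (g ^+ n.+2)%g.
have e1 k : vd (g ^+ k)%g (g ^+ k.+1)%g = wl g by rewrite expgSr vertex_distMr.
have e2 : vd (g ^+ n)%g (g ^+ n.+2)%g = wl (g ^+ 2)%g.
  by rewrite -addn2 expgnDr vertex_distMr.
rewrite !vertex_dist1l !e1 e2; move: lox; rewrite /loxodromic.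
by rewrite /maxn; case: ifP; lia.
Qed.

Lemma loxodromic_ge n : (n <= wl (g ^+ n)%g)%N.
Proof.
elim: n => // n IH; have := loxodromic_step n; move: lox.
by rewrite /loxodromic; lia.
Qed.

(** In other words, [g ^+ i] is almost on the geodesics from [1] to [g ^+ (i + j)], with a defect
    independent of [i] and [j]. *)
Lemma loxodromic_add i j :
  (wl (g ^+ i)%g + wl (g ^+ j)%g <= wl (g ^+ (i + j))%g + wl g + D)%N.
Proof.
case: i => [|i]; first by rewrite expg0 word_length1 !add0n; lia.
have := four 1%g (g ^+ i)%g (g ^+ i.+1)%g (g ^+ (i.+1 + j))%g.
have e1 : vd (g ^+ i)%g (g ^+ i.+1)%g = wl g by rewrite expgSr vertex_distMr.
have e2 : vd (g ^+ i)%g (g ^+ (i.+1 + j))%g = wl (g ^+ j.+1)%g.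
  by rewrite addSnnS expgnDr vertex_distMr.
have e3 : vd (g ^+ i.+1)%g (g ^+ (i.+1 + j))%g = wl (g ^+ j)%g.
  by rewrite expgnDr vertex_distMr.
rewrite !vertex_dist1l e1 e2 e3.
have := loxodromic_step i; have := loxodromic_step j.
by move: lox; rewrite /loxodromic /maxn; case: ifP; lia.
Qed.

Lemma power_dist h i j : (i <= j)%N ->
  vd (h * g ^+ i)%g (h * g ^+ j)%g = wl (g ^+ (j - i))%g.
Proof.
by move=> ij; rewrite vertex_distMl -{1}(subnKC ij) expgnDr vertex_distMr.
Qed.

End Powers.

Lemma pigeonhole (T : choiceType) (s : seq T) (f : nat -> T) :
  (forall n, f n \in s) -> exists i j, (i < j)%N /\ f i = f j.
Proof.
move=> fs; apply: contrapT => ninj.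
have inj : injective f.
  move=> i j fij; apply: contrapT => /eqP; rewrite neq_ltn => /orP[ij|ij];
    apply: ninj; [by exists i, j|by exists j, i].
have := @uniq_leq_size _ [seq f i | i <- iota 0 (size s).+1] s.
rewrite map_inj_uniq// iota_uniq size_map size_iota ltnn => small.
suff : false by []; apply: small => // x.
by case/mapP=> i _ ->.
Qed.

(* If the rays [a^i] and [t b^j] stay close, some conjugate by [t] of a power
   of [b] is a power of [a], so that [t] moves a whole axis near [<a>]. *)
Lemma fellow_travel_commensurate t a b E : loxodromic b ->
  (forall j, exists i, (vd (t * b ^+ j)%g (a ^+ i)%g <= E)%N) ->
  exists p q, (0 < p)%N /\ exists2 a', a' = a \/ a' = (a^-1)%g &
     (t * b ^+ p = a' ^+ q * t)%g.
Proof.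
move=> lb near; have [s sP] := word_ball_enum psi E.
have [f fE] := choice near.
have [|i [j [ij fij]]] := @pigeonhole _ s (fun j => (t * b ^+ j)^-1 * a ^+ (f j))%g.
  by move=> j; apply: sP; apply: fE.
exists (j - i)%N; rewrite subn_gt0 ij.
have bE : (b ^+ j = b ^+ (j - i) * b ^+ i)%g by rewrite -expgnDr subnK// ltnW.
have tE : (t * b ^+ (j - i) = a ^+ (f j) * (a ^+ (f i))^-1 * t)%g.
  have XE : (t * b ^+ j * ((t * b ^+ j)^-1 * a ^+ (f j)) = a ^+ (f j))%g.
    by rewrite mulVKg.
  by rewrite -XE -fij bE invgM !mulgA !mulgK mulgVK.
have [fji|/ltnW fji] := leqP (f i) (f j).
  exists (f j - f i)%N; split=> //; exists a; first by left.
  by rewrite tE -{1}(subnK fji) expgnDr mulgK.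
exists (f i - f j)%N; split=> //; exists (a^-1)%g; first by right.
by rewrite tE -{1}(subnK fji) expgnDr invgM mulVKg expVgn.
Qed.

(** The relation gives [t b^N = a^Q t] and [t b^-N = a^-Q t] for arbitrarily large [N]. So [t],
    which is almost between [t b^N] and [t b^-N], is almost between [a^Q] and [a^-Q]; once [N] is
    large with respect to [wl t], the defect no longer depends on [t]. The Morse lemma then puts [t]
    at bounded distance from the powers of [a]. *)
Lemma loxodromic_axis g : loxodromic g ->
  exists C, forall t a b, (a = g \/ a = g^-1)%g -> (b = g \/ b = g^-1)%g ->
  forall p q, (0 < p)%N -> (t * b ^+ p = a ^+ q * t)%g ->
  exists2 h, generated [set g] h & (vd t h <= C)%N.
Proof.
move=> lg.
have [C0 C0P] := morse (vertex_distxx psi) (vertex_distC psi)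
  (fun x y z => vertex_dist_triangle psi y x z) (@vertex_dist_geodesic _ _ psi) four (wl g) 1.
exists (2 * (wl g + 3 * D) + C0)%N => t a b ag bg p q p0 com.
have lab c : (c = g \/ c = g^-1)%g -> loxodromic c /\ wl c = wl g.
  by case=> ->; split => //; [exact: loxodromicV | rewrite word_lengthV].
have [la wa] := lab a ag; have [lb wb] := lab b bg.
have Ha : generated [set g] a.
  have [_ _ HV] := subgroup_generated [set g].
  by case: ag => ->; [|apply: HV]; apply: generated_sub.
pose l := (wl t + wl g + 4 * D + 1)%N.
have com' k : (t * b ^+ (p * k) = a ^+ (q * k) * t)%g.
  elim: k => [|k IH]; first by rewrite !muln0 !expg0 mulg1 mul1g.
  by rewrite !mulnS !expgnDr mulgA com -mulgA IH mulgA.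
have comV k : (t * b ^- (p * k) = a ^- (q * k) * t)%g.
  by apply: (mulgI (a ^+ (q * k))%g); rewrite mulgA -com' mulgK mulgA mulgV mul1g.
set N := (p * l)%N; set Q := (q * l)%N.
have Nl : (l <= N)%N by rewrite leq_pmull.
pose u := (t * b ^+ N)%g; pose u' := (t * b ^- N)%g.
pose v := (a ^+ Q)%g; pose v' := (a ^- Q)%g.
have uv : vd u v = wl t.
  by rewrite vertex_distC /u com' vertex_distMr.
have uv' : vd u' v' = wl t.
  by rewrite vertex_distC /u' comV vertex_distMr.
have tu : vd u t = wl (b ^+ N)%g by rewrite vertex_distC vertex_distMr.
have tu' : vd u' t = wl (b ^+ N)%g by rewrite vertex_distC vertex_distMr word_lengthV.
have uu' : vd u u' = wl (b ^+ (N + N))%g.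
  by rewrite /u /u' vertex_distMl vertex_distC /vertex_dist invgK -expgnDr.
have add := loxodromic_add lb N N.
have ge := loxodromic_ge lb N.
have ut : (vd u t <= vd u v + vd v t)%N := vertex_dist_triangle _ _ _ _.
have ut' : (vd u' t <= vd u' v' + vd v' t)%N := vertex_dist_triangle _ _ _ _.
have G1 : (vd v t + vd u' t <= vd v u' + (wl g + 2 * D))%N.
  have := four u v u' t; rewrite /l in Nl.
  by rewrite /maxn; case: ifP; lia.
have G2 : (vd v t + vd v' t <= vd v v' + (wl g + 3 * D))%N.
  have := four v v' u' t; rewrite (vertex_distC psi v' u') /l in Nl *.
  by rewrite /maxn; case: ifP; lia.
have [|||i iQ it] := C0P (fun i => v' * a ^+ i)%g (Q + Q)%N t (wl g + 3 * D)%N.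
- by move=> i _; rewrite expgSr mulgA vertex_distMr wa.
- by move=> i j /andP[ij _]; rewrite mul1n power_dist// loxodromic_ge.
- rewrite /= expg0 mulg1 expgnDr mulgA mulVg mul1g -/v.
  by rewrite (vertex_distC psi t) (vertex_distC psi v' v) addnC.
exists (v' * a ^+ i)%g => //.
have [_ HM HV] := subgroup_generated [set g].
by apply: HM; [apply: HV|]; apply: generated_expg.
Qed.

(** As [G] is not elementary, some [t] is farther from the powers of [g] than the constant of
    [loxodromic_axis]. Were the Gromov products of [a ^+ N] and [t * b ^+ N] unbounded, the two rays
    would fellow-travel, [t] would satisfy a commensuration relation, and it would be close to a
    power of [g]. *)
Lemma diverging_conjugate g : loxodromic g -> ~ elementary G ->
  exists t c, forall a b, (a = g \/ a = g^-1)%g -> (b = g \/ b = g^-1)%g ->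
  forall N, (wl (a ^+ N)%g + wl (t * b ^+ N)%g <= vd (a ^+ N)%g (t * b ^+ N)%g + c)%N.
Proof.
move=> lg nel; have [C CP] := loxodromic_axis lg.
have [t tC] : exists t, forall h, generated [set g] h -> (C < vd t h)%N.
  apply: contrapT => nt; apply: nel.
  apply: (@elementary_cobounded _ _ psi g C) => t; apply: contrapT => nh.
  apply: nt; exists t => h Hh; rewrite ltnNge; apply/negP => le.
  by apply: nh; exists h.
exists t.
suff bnd a b : (a = g \/ a = g^-1)%g -> (b = g \/ b = g^-1)%g -> exists c,
    forall N, (wl (a ^+ N)%g + wl (t * b ^+ N)%g <= vd (a ^+ N)%g (t * b ^+ N)%g + c)%N.
  have [c1 h1] := bnd g g (or_introl erefl) (or_introl erefl).
  have [c2 h2] := bnd g (g^-1)%g (or_introl erefl) (or_intror erefl).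
  have [c3 h3] := bnd (g^-1)%g g (or_intror erefl) (or_introl erefl).
  have [c4 h4] := bnd (g^-1)%g (g^-1)%g (or_intror erefl) (or_intror erefl).
  exists (c1 + c2 + c3 + c4)%N => a b [->|->] [->|->] N;
    [have := h1 N|have := h2 N|have := h3 N|have := h4 N]; lia.
move=> ag bg; apply: contrapT => unb.
have lab c : (c = g \/ c = g^-1)%g -> loxodromic c /\ wl c = wl g.
  by case=> ->; split => //; [exact: loxodromicV | rewrite word_lengthV].
have [la wa] := lab a ag; have [lb wb] := lab b bg.
have {}unb c : exists N,
    (vd (a ^+ N)%g (t * b ^+ N)%g + c < wl (a ^+ N)%g + wl (t * b ^+ N)%g)%N.
  apply: contrapT => nN; apply: unb; exists c => N.
  by rewrite leqNgt; apply/negP => h; apply: nN; exists N.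
have [C0 C0P] := morse (vertex_distxx psi) (vertex_distC psi)
  (fun x y z => vertex_dist_triangle psi y x z) (@vertex_dist_geodesic _ _ psi) four (wl g) 1.
pose r := (2 * wl t + wl g + 2 * D)%N.
have [|p [q [p0 [a' a'a com]]]] := @fellow_travel_commensurate t a b (2 * r + C0) lb.
  move=> j.
  (* The second term forces [j <= N]; the first puts [t * b ^+ j] on the initial part common to the
     geodesics to [a ^+ N] and to [t * b ^+ N]. *)
  have [N NP] := unb (2 * wl (t * b ^+ j)%g + 2 * (j * wl g))%N.
  have tri : (wl (t * b ^+ N)%g <= vd (a ^+ N)%g (t * b ^+ N)%g + wl (a ^+ N)%g)%N.
    by rewrite -!(vertex_dist1l psi) addnC vertex_dist_triangle.
  have aN := word_length_expg psi a N; rewrite wa in aN.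
  have jN : (j <= N)%N.
    rewrite leqNgt; apply/negP => Nj.
    have : (N * wl g <= j * wl g)%N by rewrite leq_mul2r ltnW ?orbT.
    lia.
  have bj := word_lengthM psi t (b ^+ j)%g.
  have bN : (wl (b ^+ N)%g <= wl (t * b ^+ N)%g + wl t)%N.
    by have := word_lengthM psi (t^-1)%g (t * b ^+ N)%g; rewrite mulKg word_lengthV addnC.
  have add := loxodromic_add lb j (N - j)%N; rewrite subnKC// in add.
  have yy : vd (t * b ^+ j)%g (t * b ^+ N)%g = wl (b ^+ (N - j))%g.
    by rewrite (power_dist _ _ jN).
  have f4 := four (t * b ^+ j)%g (t * b ^+ N)%g (a ^+ N)%g 1%g.
  rewrite !(vertex_distC psi _ 1%g) !vertex_dist1l in f4.
  rewrite yy (vertex_distC psi (t * b ^+ N)%g) in f4.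
  have [|||i iN ib] := C0P (fun i => a ^+ i)%g N (t * b ^+ j)%g r.
  - by move=> i _; rewrite expgSr vertex_distMr wa.
  - move=> i k /andP[ik _]; rewrite mul1n -(mul1g (a ^+ i)%g) -(mul1g (a ^+ k)%g).
    by rewrite power_dist// loxodromic_ge.
  - rewrite /= expg0 !vertex_dist1l; move: f4.
    by rewrite /maxn; case: ifP; rewrite /r; lia.
  by exists i.
have [h Hh th] : exists2 h, generated [set g] h & (vd t h <= C)%N.
  apply: (CP t a' b _ bg p q p0 com).
  by case: ag a'a => -> [->|->]; rewrite ?invgK; auto.
by have := tC h Hh; rewrite ltnNge th.
Qed.

(* With four long elements pointing in diverging directions, at most one of the
   four translates of [x] can be shorter than expected, so a function decreasing
   geometrically with the word length is strictly superharmonic; for the ratio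
   7/8 the average is at most (3 * (7/8) + (8/7)^2) / 4 < (79/20) / 4 < 1. *)
Lemma superharmonic_exists (R : realType) : ~ elementary G ->
  exists f e : G, exists h : G -> R, (forall x, 0 < h x) /\
  forall x, h (x * f)%g + h (x * f^-1)%g + h (x * e)%g + h (x * e^-1)%g
    <= 79 / 20 * h x.
Proof.
move=> nel; have [g lg] := loxodromic_exists nel.
have [t [c tc]] := diverging_conjugate lg nel.
have [c1 c1E] : exists c1, c1 = (c + wl g + D + 6 * wl t)%N by eexists.
(* Here [c1] bounds the six mutual doubled Gromov products. A translate without excessive
   cancellation is longer by at least [Q = A - 2 * wl t - c1 - D], and any translate is shorter by
   at most [A + 2 * wl t]. This [N] makes the latter at most [2 * Q], whence the factors [7 / 8] and
   [(8 / 7) ^+ 2]. *)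
have [N NE] : exists N, N = (6 * wl t + 2 * c1 + 2 * D + 1)%N by eexists.
have [A AE] : exists A, A = wl (g ^+ N)%g by eexists.
have AN := loxodromic_ge lg N; rewrite -AE in AN.
have [Q QE] : exists Q, Q = (A - 2 * wl t - c1 - D)%N by eexists.
have Q0 : (0 < Q)%N by rewrite QE; lia.
pose f := (g ^+ N)%g; pose e := (t * g ^+ N * t^-1)%g.
have eV : (e^-1 = t * g^-1 ^+ N * t^-1)%g.
  by rewrite /e !invgM invgK expVgn mulgA.
have fV : (f^-1 = g^-1 ^+ N)%g by rewrite expVgn.
have wf : wl f = A by rewrite AE.
have wfV : wl (f^-1)%g = A by rewrite word_lengthV.
have we : (wl e <= A + 2 * wl t)%N by rewrite AE; exact: word_length_conj.
have we' : (A <= wl e + 2 * wl t)%N by rewrite AE; exact: word_length_conj_ge.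
have weV : wl (e^-1)%g = wl e by rewrite word_lengthV.
have add := loxodromic_add lg N N; rewrite -AE in add.
have vdV x : vd x (x^-1)%g = wl (x * x)%g by rewrite vertex_distC /vertex_dist invgK.
have ff : (f * f = g ^+ (N + N))%g by rewrite expgnDr.
have pff : (wl f + wl (f^-1)%g <= vd f (f^-1)%g + c1)%N.
  by rewrite vdV wfV wf ff c1E; lia.
have pee : (wl e + wl (e^-1)%g <= vd e (e^-1)%g + c1)%N.
  rewrite vdV weV (_ : e * e = t * g ^+ (N + N) * t^-1)%g; last first.
    by rewrite /e expgnDr !mulgA mulgVK.
  by have := word_length_conj_ge psi t (g ^+ (N + N))%g; rewrite c1E; lia.
have pab a b : (a = g \/ a = g^-1)%g -> (b = g \/ b = g^-1)%g ->
    (wl (a ^+ N)%g + wl (t * b ^+ N * t^-1)%g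
      <= vd (a ^+ N)%g (t * b ^+ N * t^-1)%g + c1)%N.
  move=> ag bg; have := tc a b ag bg N.
  have := word_lengthM psi (t * b ^+ N)%g (t^-1)%g.
  have := vertex_dist_triangle psi (t * b ^+ N * t^-1)%g (a ^+ N)%g (t * b ^+ N)%g.
  by rewrite (vertex_distC _ (_ * t^-1)%g) vertex_distMr !word_lengthV c1E; lia.
have pfe : (wl f + wl e <= vd f e + c1)%N by apply: pab; left.
have pfe' : (wl f + wl (e^-1)%g <= vd f (e^-1)%g + c1)%N.
  by rewrite eV; apply: pab; [left|right].
have pf'e : (wl (f^-1)%g + wl e <= vd (f^-1)%g e + c1)%N.
  by rewrite fV; apply: pab; [right|left].
have pf'e' : (wl (f^-1)%g + wl (e^-1)%g <= vd (f^-1)%g (e^-1)%g + c1)%N.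
  by rewrite fV eV; apply: pab; right.
pose h x : R := (7 / 8) ^+ (wl x %/ Q).
have h0 x : 0 < h x by rewrite exprn_gt0.
exists f, e, h; split => // x.
pose good s := (wl x + wl s <= wl (x * s)%g + c1 + D)%N.
have dx s : vd s (x^-1)%g = wl (x * s)%g.
  by rewrite vertex_distC /vertex_dist invgK.
have ds s : vd s 1%g = wl s by rewrite vertex_distC vertex_dist1l.
have gooder s s' : (wl s + wl s' <= vd s s' + c1)%N -> good s || good s'.
  move=> ss; have := four s (x^-1)%g s' 1%g.
  rewrite dx (vertex_distC _ (x^-1)%g s') dx !ds word_lengthV /good.
  by rewrite /maxn; case: ifP; lia.
have goodh s : (A <= wl s + 2 * wl t)%N -> good s -> h (x * s)%g <= 7 / 8 * h x.
  move=> sA; rewrite /good => gs; rewrite /h -exprS; apply: ler_wiXn2l; [lra|lra|].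
  have -> : ((wl x %/ Q).+1 = (wl x + Q) %/ Q)%N by rewrite divnDr// divnn Q0 addn1.
  by apply: leq_div2r; rewrite QE; lia.
have anyh s : (wl s <= A + 2 * wl t)%N -> h (x * s)%g <= 64 / 49 * h x.
  move=> sA; suff : (7 / 8) ^+ (2 + wl (x * s)%g %/ Q) <= h x.
    by rewrite exprD -/(h (x * s)%g) expr2; have := h0 (x * s)%g; lra.
  rewrite /h; apply: ler_wiXn2l; [lra|lra|].
  have -> : (2 + wl (x * s)%g %/ Q = (wl (x * s)%g + 2 * Q) %/ Q)%N.
    by rewrite divnDr ?dvdn_mull// mulnK// addnC.
  have := word_lengthM psi (x * s)%g (s^-1)%g; rewrite mulgK word_lengthV => tri.
  by apply: leq_div2r; rewrite QE; lia.
have hf : (A <= wl f + 2 * wl t)%N by rewrite wf leq_addr.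
have hf' : (A <= wl (f^-1)%g + 2 * wl t)%N by rewrite wfV leq_addr.
have he' : (A <= wl (e^-1)%g + 2 * wl t)%N by rewrite weV.
have af : h (x * f)%g <= 64 / 49 * h x by apply: anyh; rewrite wf leq_addr.
have af' : h (x * f^-1)%g <= 64 / 49 * h x by apply: anyh; rewrite wfV leq_addr.
have ae : h (x * e)%g <= 64 / 49 * h x by apply: anyh.
have ae' : h (x * e^-1)%g <= 64 / 49 * h x by apply: anyh; rewrite weV.
have x0 := h0 x.
move: (gooder _ _ pff) (gooder _ _ pee) (gooder _ _ pfe).
move: (gooder _ _ pfe') (gooder _ _ pf'e) (gooder _ _ pf'e').
have [gf|_] := boolP (good f); [have := goodh _ hf gf|];
  (have [gf'|_] := boolP (good (f^-1)%g); [have := goodh _ hf' gf'|]);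
  (have [ge|_] := boolP (good e); [have := goodh _ we' ge|]);
  (have [ge'|_] := boolP (good (e^-1)%g); [have := goodh _ he' ge'|]);
  rewrite ?orbT ?orbF //=; intros; lra.
Qed.

End Loxodromic.

(** * The spectral gap *)

Section FiniteSums.
Variables (R : realType) (G : groupType).
Implicit Types (F H : G -> R) (s : G).

Definition gsum F : R := \sum_(x \in [set: G]) F x.

Definition fsupp F := exists A : {fset G}, forall x, x \notin A -> F x = 0.

Lemma gsumE (A : {fset G}) F :
  (forall x, x \notin A -> F x = 0) -> gsum F = \sum_(x <- A) F x.
Proof. exact: fsbigTE. Qed.

Lemma fsuppMl F H : fsupp F -> fsupp (fun x => F x * H x).
Proof. by move=> [A AF]; exists A => x /AF ->; rewrite mul0r. Qed.

Lemma fsuppMr F H : fsupp F -> fsupp (fun x => H x * F x).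
Proof. by move=> [A AF]; exists A => x /AF ->; rewrite mulr0. Qed.

Lemma fsuppD F H : fsupp F -> fsupp H -> fsupp (fun x => F x + H x).
Proof.
move=> [A AF] [B BH]; exists (A `|` B)%fset => x.
by rewrite in_fsetU negb_or => /andP[/AF -> /BH ->]; rewrite addr0.
Qed.

Lemma fsupp_norm F : fsupp F -> fsupp (fun x => `|F x|).
Proof. by move=> [A AF]; exists A => x /AF ->; rewrite normr0. Qed.

Lemma fsupp_sum (I : Type) (r : seq I) (F : I -> G -> R) :
  (forall i, fsupp (F i)) -> fsupp (fun x => \sum_(i <- r) F i x).
Proof.
move=> hF; elim: r => [|i r IH].
  by exists fset0 => x _; rewrite big_nil.
by have [A AF] := fsuppD (hF i) IH; exists A => x /AF; rewrite big_cons.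
Qed.

Lemma fsupp_shift F s : fsupp F -> fsupp (fun x => F (x * s)%g).
Proof.
move=> [A AF]; exists [fset (x * s^-1)%g | x in A]%fset => x xA.
apply: AF; apply: contra xA => xA; apply/imfsetP; exists (x * s)%g => //.
by rewrite mulgK.
Qed.

Lemma fsuppB F H : fsupp F -> fsupp H -> fsupp (fun x => F x - H x).
Proof.
move=> [A AF] [B BH]; exists (A `|` B)%fset => x.
by rewrite in_fsetU negb_or => /andP[/AF -> /BH ->]; rewrite subr0.
Qed.

Lemma gsumD F H : fsupp F -> fsupp H ->
  gsum (fun x => F x + H x) = gsum F + gsum H.
Proof.
move=> [A AF] [B BH]; pose C := (A `|` B)%fset.
have CF x : x \notin C -> F x = 0 by rewrite in_fsetU negb_or => /andP[/AF].
have CH x : x \notin C -> H x = 0 by rewrite in_fsetU negb_or => /andP[_ /BH].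
rewrite (gsumE CF) (gsumE CH) (@gsumE C) ?big_split// => x xC.
by rewrite CF// CH// addr0.
Qed.

Lemma gsumZ a F : fsupp F -> gsum (fun x => a * F x) = a * gsum F.
Proof.
move=> [A AF]; rewrite (gsumE AF) (@gsumE A) ?mulr_sumr// => x /AF ->.
by rewrite mulr0.
Qed.

Lemma gsum_sum (I : Type) (r : seq I) (F : I -> G -> R) :
  (forall i, fsupp (F i)) ->
  gsum (fun x => \sum_(i <- r) F i x) = \sum_(i <- r) gsum (F i).
Proof.
move=> hF; elim: r => [|i r IH].
  by rewrite big_nil (@gsumE fset0) ?big_seq_fset0// => x _; rewrite big_nil.
rewrite big_cons -IH -gsumD//; last exact: fsupp_sum.
by congr gsum; apply/funext => x; rewrite big_cons.
Qed.

Lemma ler_gsum F H : fsupp F -> fsupp H -> (forall x, F x <= H x) ->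
  gsum F <= gsum H.
Proof.
move=> [A AF] [B BH] le; pose C := (A `|` B)%fset.
have CF x : x \notin C -> F x = 0 by rewrite in_fsetU negb_or => /andP[/AF].
have CH x : x \notin C -> H x = 0 by rewrite in_fsetU negb_or => /andP[_ /BH].
by rewrite (gsumE CF) (gsumE CH) ler_sum.
Qed.

Lemma gsum_ge0 F : fsupp F -> (forall x, 0 <= F x) -> 0 <= gsum F.
Proof. by move=> [A AF] F0; rewrite (gsumE AF) sumr_ge0. Qed.

Lemma gsum_ge F x : fsupp F -> (forall x, 0 <= F x) -> F x <= gsum F.
Proof.
move=> [A AF] F0; have [xA|xA] := boolP (x \in A).
  by rewrite (gsumE AF) (big_fsetD1 x)//= lerDl sumr_ge0.
by rewrite AF// (gsumE AF) sumr_ge0.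
Qed.

Lemma gsum_shift F s : gsum (fun x => F (x * s)%g) = gsum F.
Proof.
have bij : bijective (fun x : G => (x * s)%g).
  by exists (fun x : G => (x * s^-1)%g) => x; rewrite ?mulgK ?mulgVK.
by rewrite /gsum [RHS](reindex_fsbigT _ F bij).
Qed.

Lemma fsupp_delta g F : fsupp (fun x => (g == x)%:R * F x).
Proof.
by exists [fset g]%fset => x; rewrite in_fset1 eq_sym => /negPf ->; rewrite mul0r.
Qed.

Lemma gsum_delta g F : gsum (fun x => (g == x)%:R * F x) = F g.
Proof.
rewrite (@gsumE [fset g]%fset) ?big_seq_fset1 ?eqxx ?mul1r// => x.
by rewrite in_fset1 eq_sym => /negPf ->; rewrite mul0r.
Qed.

End FiniteSums.

(** * Displacement of finitely supported functions under right translation *)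

Section Energy.
Variables (R : realType) (G : groupType) (u : G -> R).
Hypothesis us : fsupp u.

(** With [rho] the right regular representation, the next three are [||u||^2], [<u, rho(s) u>] and
    [||rho(s) u - u||^2]. *)
Definition sqnorm := gsum (fun x => u x ^+ 2).
Definition corr (s : G) := gsum (fun x => u x * u (x * s)%g).
Definition energy (s : G) := gsum (fun x => (u (x * s)%g - u x) ^+ 2).

Lemma fsupp_sqr : fsupp (fun x => u x ^+ 2).
Proof. by under eq_fun do rewrite expr2; exact: fsuppMl. Qed.

Lemma fsupp_diff s t : fsupp (fun x => (u (x * s)%g - u (x * t)%g) ^+ 2).
Proof.
under eq_fun do rewrite expr2; apply: fsuppMl.
by apply: fsuppB; exact: fsupp_shift.
Qed.

Lemma fsupp_energy s : fsupp (fun x => (u (x * s)%g - u x) ^+ 2).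
Proof. by have := fsupp_diff s 1%g; under eq_fun do rewrite mulg1. Qed.

Lemma energyE s : energy s = 2 * sqnorm - 2 * corr s.
Proof.
have c : fsupp (fun x => u x * u (x * s)%g) by exact: fsuppMl.
have q := fsupp_sqr.
have qs : fsupp (fun x => u (x * s)%g ^+ 2) by exact: (fsupp_shift s q).
have E : (fun x => (u (x * s)%g - u x) ^+ 2)
   = (fun x => (u (x * s)%g ^+ 2 + u x ^+ 2) + (-2) * (u x * u (x * s)%g)).
  by apply/funext => x; ring.
rewrite /energy E (gsumD (fsuppD qs q) (fsuppMr _ c)) (gsumD qs q) (gsumZ _ c).
by rewrite (gsum_shift (fun x => u x ^+ 2)) -/sqnorm -/(corr s); ring.
Qed.

Lemma energyM s t : energy (s * t)%g <= 2 * energy s + 2 * energy t.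
Proof.
have E : energy t = gsum (fun x => (u (x * (s * t))%g - u (x * s)%g) ^+ 2).
  rewrite /energy -(gsum_shift (fun x => (u (x * t)%g - u x) ^+ 2) s).
  by congr gsum; apply/funext => x; rewrite mulgA.
have es := fsuppMr (fun=> 2) (fsupp_energy s).
have et := fsuppMr (fun=> 2) (fsupp_diff (s * t)%g s).
rewrite E -(gsumZ _ (fsupp_energy s)) -(gsumZ _ (fsupp_diff (s * t)%g s)).
rewrite -(gsumD es et).
apply: ler_gsum; [exact: fsupp_energy|exact: fsuppD|].
move=> x; set a := u (x * _)%g; set b := u (x * s)%g; set c := u x.
have := sqr_ge0 ((a - b) - (b - c)); nra.
Qed.

Lemma energy1 : energy 1%g = 0.
Proof.
rewrite energyE /corr /sqnorm; under [X in _ - 2 * gsum X]eq_fun do rewrite mulg1 -expr2.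
by rewrite subrr.
Qed.

Lemma energy_ge0 s : 0 <= energy s.
Proof. by apply: gsum_ge0 => [|x]; [exact: fsupp_energy|exact: sqr_ge0]. Qed.

(* AM-GM weighted by [h]: [2 u(x) u(xs) <= u(x)^2 h(xs)/h(x) + u(xs)^2 h(x)/h(xs)]. *)
Lemma corr_le (h : G -> R) (h0 : forall x, 0 < h x) s :
  2 * corr s <= gsum (fun x => u x ^+ 2 * ((h (x * s)%g + h (x * s^-1)%g) / h x)).
Proof.
pose w x := u x ^+ 2 * (h (x * s^-1)%g / h x).
have ws : fsupp w by apply: fsuppMl; exact: fsupp_sqr.
have vs : fsupp (fun x => u x ^+ 2 * (h (x * s)%g / h x)).
  by apply: fsuppMl; exact: fsupp_sqr.
under [X in _ <= gsum X]eq_fun do rewrite mulrDl mulrDr.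
rewrite gsumD// -/w -(gsum_shift w s) -gsumD//; last exact: fsupp_shift.
rewrite -gsumZ; last exact: fsuppMl.
apply: ler_gsum; first by apply: fsuppMr; exact: fsuppMl.
  by apply: fsuppD => //; exact: fsupp_shift.
move=> x; rewrite /w mulgK.
have := h0 x; have := h0 (x * s)%g; move: (h x) (h (x * s)%g) (u x) (u (x * s)%g).
move=> p q a b q0 p0.
have -> : a ^+ 2 * (q / p) + b ^+ 2 * (p / q) = (a * q - b * p) ^+ 2 / (p * q) + 2 * (a * b).
  by field; rewrite !gt_eqF.
by rewrite lerDr divr_ge0 ?sqr_ge0// mulr_ge0 ?ltW.
Qed.

(** The sum of the two energies is [4 * sqnorm - 2 * (corr f + corr e)], and [corr_le] bounds the
    subtracted term by [79 / 20 * sqnorm]; the factor 20 is the inverse of [4 - 79 / 20]. *)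
Lemma energy_superharmonic (h : G -> R) f e : (forall x, 0 < h x) ->
  (forall x, h (x * f)%g + h (x * f^-1)%g + h (x * e)%g + h (x * e^-1)%g
    <= 79 / 20 * h x) ->
  sqnorm <= 20 * (energy f + energy e).
Proof.
move=> h0 sh; rewrite !energyE.
have cf := corr_le h0 f; have ce := corr_le h0 e.
suff : 2 * corr f + 2 * corr e <= 79 / 20 * sqnorm by lra.
apply: (le_trans (lerD cf ce)); rewrite -gsumD; try (apply: fsuppMl; exact: fsupp_sqr).
rewrite -gsumZ; last exact: fsupp_sqr.
apply: ler_gsum.
- by apply: fsuppD; apply: fsuppMl; exact: fsupp_sqr.
- by apply: fsuppMr; exact: fsupp_sqr.
move=> x; rewrite -mulrDr -mulrDl mulrC ler_wpM2r ?sqr_ge0//.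
by rewrite ler_pdivrMr// addrA.
Qed.

End Energy.

(** * Words of a fixed length *)

Section Words.
Variable m : nat.
Implicit Types (u v w : word m).

Fixpoint words (l : nat) : seq (word m) :=
  if l is l'.+1 then [seq rcons w a | w <- words l', a <- enum {: letter m}]
  else [:: [::]].

Lemma mem_words l w : (w \in words l) = (size w == l).
Proof.
elim: l w => [|l IH] w; first by rewrite inE size_eq0.
apply/allpairsP/eqP => [[[v a] /= [vl _ ->]]|].
  by rewrite size_rcons; move: vl; rewrite IH => /eqP ->.
case/lastP: w => // v a; rewrite size_rcons => -[vl].
by exists (v, a); split; rewrite ?mem_enum// IH vl.
Qed.

Lemma uniq_words l : uniq (words l).
Proof.
elim: l => //= l IH; apply: allpairs_uniq; rewrite ?enum_uniq//.
by move=> [u a] [v b] _ _ /= /rcons_inj [-> ->].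
Qed.

Lemma size_words l : size (words l) = (m.*2 ^ l)%N.
Proof.
elim: l => //= l IH; rewrite size_allpairs IH -cardE card_prod card_ord card_bool.
by rewrite muln2 expnSr.
Qed.

Lemma big_words_cat (R : nmodType) (F : word m -> R) i j :
  \sum_(w <- words (i + j)) F w = \sum_(u <- words i) \sum_(v <- words j) F (u ++ v).
Proof.
elim: j F => [|j IH] F.
  by rewrite addn0; apply: eq_bigr => u _; rewrite big_seq1 cats0.
rewrite addnS big_allpairs_dep/= IH; apply: eq_bigr => u _.
rewrite big_allpairs_dep/=; apply: eq_bigr => v _; apply: eq_bigr => a _.
by rewrite rcons_cat.
Qed.

Lemma letter_invK : involutive (@letter_inv m).
Proof. by case=> i b; rewrite /letter_inv /= negbK. Qed.

Lemma word_invK : involutive (@word_inv m).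
Proof.
by move=> w; rewrite /word_inv map_rev revK -map_comp map_id_in// => a _; exact: letter_invK.
Qed.

Lemma size_word_inv w : size (word_inv w) = size w.
Proof. by rewrite size_rev size_map. Qed.

Lemma word_inv_cat u v : word_inv (u ++ v) = word_inv v ++ word_inv u.
Proof. by rewrite /word_inv map_cat rev_cat. Qed.

Lemma big_words_inv (R : nmodType) (F : word m -> R) l :
  \sum_(w <- words l) F (word_inv w) = \sum_(w <- words l) F w.
Proof.
rewrite -(big_map (@word_inv m) predT F); apply: perm_big; apply: uniq_perm.
- by rewrite map_inj_uniq ?uniq_words//; exact: inv_inj word_invK.
- exact: uniq_words.
- move=> w; rewrite -[w in LHS]word_invK mem_map; last exact: inv_inj word_invK.
  by rewrite !mem_words size_word_inv.
Qed.

End Words.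

Section Cogrowth.
Variables (R : realType) (m : nat) (G : groupType) (phi : generators m G).

Definition hits (l : nat) (g : G) : R := \sum_(w <- words m l) (phi w == g)%:R.

Definition adjacency (u : G -> R) (x : G) : R := \sum_(a : letter m) u (x * phi [:: a])%g.

Lemma hits_ge0 l g : 0 <= hits l g.
Proof. by rewrite sumr_ge0. Qed.

Lemma fsupp_hits l : fsupp (hits l).
Proof.
exists [fset phi w | w in words m l]%fset => x xn; rewrite /hits big1_seq// => w /= wl.
by apply/eqP; rewrite pnatr_eq0 eqb0; apply: contra xn => /eqP <-; apply/imfsetP; exists w.
Qed.

Lemma hits_invg l g : hits l (g^-1)%g = hits l g.
Proof.
rewrite /hits -big_words_inv; apply: eq_bigr => w _.
by rewrite word_val_inv eqg_inv.
Qed.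

Lemma hits0 : hits 0 1%g = 1.
Proof. by rewrite /hits big_seq1 word_val_nil eqxx. Qed.

Lemma adjacency_hits l : adjacency (hits l) = hits l.+1.
Proof.
apply/funext => x; rewrite /adjacency /hits exchange_big /= big_allpairs_dep/=.
apply: eq_bigr => w _; rewrite big_enum/=.
rewrite (reindex_inj (inv_inj (@letter_invK m))); apply: eq_bigr => a _.
rewrite -cats1 word_val_cat (_ : [:: letter_inv a] = word_inv [:: a])//.
by rewrite word_val_inv; congr (_%:R); congr nat_of_bool; apply/eqP/eqP => [->|<-];
  rewrite ?mulgVK ?mulgK.
Qed.

(** Cut a word representing [1] after [s] letters: the inverse of the second half represents the
    same element as the first half. *)
Lemma gsum_hits s t : gsum (fun x => hits s x * hits t x) = hits (s + t) 1%g.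
Proof.
rewrite {1 3}/hits big_words_cat.
under eq_fun do rewrite mulr_suml.
rewrite gsum_sum => [|w]; last exact: fsupp_delta.
apply: eq_bigr => w _; rewrite gsum_delta -hits_invg /hits; apply: eq_bigr => v _.
congr (_%:R); congr nat_of_bool; rewrite word_val_cat.
by apply/eqP/eqP => [->|/mulg1_eq ->//]; rewrite mulgV.
Qed.

Lemma adjacency_form (u : G -> R) : fsupp u ->
  gsum (fun x => u x * adjacency u x) = \sum_(a : letter m) corr u (phi [:: a]).
Proof.
move=> us; rewrite -gsum_sum; last by move=> a; exact: fsuppMl.
by congr gsum; apply/funext => x; rewrite /adjacency mulr_sumr.
Qed.

(** This carries the lower bound on the energies of [f] and [e], elements found by geometry in
    [psi], over to the letters of [phi]. *)
Lemma energy_word w : exists2 C, 0 <= C & forall u : G -> R, fsupp u ->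
  energy u (phi w) <= C * \sum_(a : letter m) energy u (phi [:: a]).
Proof.
elim: w => [|a w [C C0 IH]].
  by exists 0 => // u us; rewrite word_val_nil energy1// mul0r.
exists (2 + 2 * C) => [|u us]; first by rewrite addr_ge0// mulr_ge0.
rewrite -cat1s word_val_cat (le_trans (energyM us _ _))//.
have := IH u us; set S := \sum_(_ | _) _.
have : energy u (phi [:: a]) <= S.
  by rewrite /S (bigD1 a)//= lerDl sumr_ge0// => b _; exact: energy_ge0.
by move: C0; nra.
Qed.

End Cogrowth.

(** If [S] is the sum of the energies of the letters, then
    [<v, adjacency v> = 2m * sqnorm v - S / 2], so a lower bound on [S] by a multiple of [sqnorm v]
    is a gap below [2m]. *)
Lemma adjacency_gap (R : realType) (m : nat) (G : groupType)
    (phi : generators m G) (f e : G) (h : G -> R) :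
  (1 < m)%N -> (forall x, 0 < h x) ->
  (forall x, h (x * f)%g + h (x * f^-1)%g + h (x * e)%g + h (x * e^-1)%g
    <= 79 / 20 * h x) ->
  exists2 kappa, 1 <= kappa < (m.*2)%:R & forall u : G -> R, fsupp u ->
    `|gsum (fun x => u x * adjacency phi u x)| <= kappa * sqnorm u.
Proof.
move=> m1 h0 sh.
have [wf wfE] := word_val_surj phi f; have [we weE] := word_val_surj phi e.
have [Cf Cf0 fP] := energy_word R phi wf; have [Ce Ce0 eP] := energy_word R phi we.
(* The 20 of [energy_superharmonic], doubled for [S / 2]; the summand 1 ensures [C^-1 <= 1], hence
   [kappa >= 1]. *)
pose C := 40 * (Cf + Ce + 1).
have C40 : 40 <= C by rewrite /C; lra.
have q4 : 4 <= (m.*2)%:R :> R by rewrite ler_nat -muln2 (leq_mul2r 2 2 m) m1 orbT.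
have iC : 0 < C^-1 <= 1.
  by rewrite invr_gt0 invf_le1; lra.
exists ((m.*2)%:R - C^-1); first by lra.
move=> u us.
have bound v : fsupp v -> gsum (fun x => v x * adjacency phi v x) <= ((m.*2)%:R - C^-1) * sqnorm v.
  move=> vs; rewrite adjacency_form//.
  have := energy_superharmonic vs h0 sh; rewrite -wfE -weE => sq.
  have {}fP := fP v vs; have {}eP := eP v vs.
  set S := \sum_(a : letter m) energy v (phi [:: a]) in fP eP.
  have SE : S = 2 * (m.*2)%:R * sqnorm v - 2 * \sum_(a : letter m) corr v (phi [:: a]).
    rewrite /S; under eq_bigr do rewrite energyE//.
    rewrite sumrB -mulr_sumr sumr_const -mulr_sumr card_prod card_ord card_bool.
    by rewrite muln2 -mulr_natl; ring.
  have S0 : 0 <= S by apply: sumr_ge0 => a _; exact: energy_ge0.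
  have le : sqnorm v <= 20 * ((Cf + Ce + 1) * S) by lra.
  have {}le : sqnorm v / C <= S / 2.
    rewrite ler_pdivrMr; last by lra.
    by rewrite /C; apply: (le_trans le); lra.
  by move: le; rewrite SE; lra.
(* The energies bound the form only from above. Since [|<u, adjacency u>|] is at most
   [<|u|, adjacency |u|>], the upper bound for [|u|] gives both bounds for [u]. *)
have us' := fsupp_norm us.
have := bound _ us'; rewrite /sqnorm; under [X in _ * gsum X]eq_fun do rewrite real_normK ?num_real//.
apply: le_trans.
have s1 : fsupp (fun x => u x * adjacency phi u x) by exact: fsuppMl.
have s2 : fsupp (fun x => `|u x| * adjacency phi (fun x => `|u x|) x) by exact: fsuppMl.
have le x : `|u x * adjacency phi u x| <= `|u x| * adjacency phi (fun x => `|u x|) x.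
  by rewrite normrM ler_wpM2l// ler_norm_sum.
rewrite ler_norml; apply/andP; split.
  rewrite -mulN1r -gsumZ//; apply: ler_gsum => // [|x]; first exact: fsuppMr.
  by rewrite mulN1r lerNl (le_trans _ (le x))// -normrN ler_norm.
by apply: ler_gsum => // x; rewrite (le_trans _ (le x))// ler_norm.
Qed.

Section NormBound.
Variables (R : realType) (m : nat) (G : groupType) (phi : generators m G).
Variable kappa : R.
Hypothesis kappa1 : 1 <= kappa.
Hypothesis gap : forall u : G -> R, fsupp u ->
  `|gsum (fun x => u x * adjacency phi u x)| <= kappa * sqnorm u.

(* Polarization: apply the bound on the quadratic form to
   [hits t + hits t.+1 / kappa] and to [hits t - hits t.+1 / kappa]. *)
Lemma hits_even_step t :
  hits R phi (t.+1 + t.+1) 1%g <= kappa ^+ 2 * hits R phi (t + t) 1%g.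
Proof.
pose N := hits R phi.
have form c :
    sqnorm (fun x => N t x + c * N t.+1 x)
      = N (t + t)%N 1%g + 2 * c * N (t + t.+1)%N 1%g + c ^+ 2 * N (t.+1 + t.+1)%N 1%g /\
    gsum (fun x => (N t x + c * N t.+1 x) * adjacency phi (fun x => N t x + c * N t.+1 x) x)
      = N (t + t.+1)%N 1%g + 2 * c * N (t.+1 + t.+1)%N 1%g + c ^+ 2 * N (t.+1 + t.+2)%N 1%g.
  have adj x : adjacency phi (fun x => N t x + c * N t.+1 x) x = N t.+1 x + c * N t.+2 x.
    have EA l : N l.+1 x = \sum_(a : letter m) N l (x * phi [:: a])%g.
      by rewrite /N -[in LHS]adjacency_hits.
    by rewrite /adjacency big_split/= -mulr_sumr -!EA.
  have prod (a b a' b' : nat) :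
      gsum (fun x => (N a x + c * N b x) * (N a' x + c * N b' x))
      = N (a + a')%N 1%g + c * N (a + b')%N 1%g + c * N (b + a')%N 1%g + c ^+ 2 * N (b + b')%N 1%g.
    rewrite /N -!gsum_hits.
    have E : (fun x => (hits R phi a x + c * hits R phi b x) * (hits R phi a' x + c * hits R phi b' x))
      = (fun x => ((hits R phi a x * hits R phi a' x + c * (hits R phi a x * hits R phi b' x))
                 + c * (hits R phi b x * hits R phi a' x)) + c ^+ 2 * (hits R phi b x * hits R phi b' x)).
      by apply/funext => x; ring.
    have s i j : fsupp (fun x => hits R phi i x * hits R phi j x).
      by apply: fsuppMl; exact: fsupp_hits.
    rewrite E gsumD ?gsumD ?gsumZ//; do ?apply: fsuppD => //; try exact: fsuppMr.
  split.
    rewrite /sqnorm; under eq_fun do rewrite expr2.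
    by rewrite prod (addnC t.+1 t); ring.
  under eq_fun do rewrite adj.
  by rewrite prod addSnnS; ring.
have k0 : 0 < kappa := lt_le_trans ltr01 kappa1.
have fs c : fsupp (fun x => N t x + c * N t.+1 x).
  by apply: fsuppD; [|apply: fsuppMr]; exact: fsupp_hits.
have [sp gp] := form kappa^-1; have [sm gm] := form (- kappa^-1).
have := gap (fs kappa^-1); have := gap (fs (- kappa^-1)).
rewrite sp gp sm gm -/N !ler_norml => /andP[lo _] /andP[_ hi].
move: lo hi; move: (N (t + t)%N 1%g) (N (t + t.+1)%N 1%g).
move: (N (t.+1 + t.+1)%N 1%g) (N (t.+1 + t.+2)%N 1%g) => c d a b.
have : kappa * kappa^-1 = 1 by rewrite divff// gt_eqF.
set k' := kappa^-1 => kk' lo hi.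
(* In the difference of the two bounds the counts of odd length, [b] and [d], cancel. *)
have {lo hi} : 4 * k' * c <= 2 * kappa * a + 2 * (kappa * k') * k' * c by lra.
rewrite kk' => le; have : k' * c <= kappa * a by lra.
move=> /(ler_wpM2l (ltW k0)); rewrite mulrA kk' mul1r mulrA -expr2.
by [].
Qed.

(** The square of [hits t g] is one term of the sum of the squares of [hits t], which counts the
    words of length [t + t] representing [1]. *)
Lemma hits_le t g : hits R phi t g <= kappa ^+ t.
Proof.
have k0 : 0 <= kappa := le_trans ler01 kappa1.
have even s : hits R phi (s + s) 1%g <= kappa ^+ (s + s).
  elim: s => [|s IH]; first by rewrite hits0.
  apply: (le_trans (hits_even_step s)).
  by rewrite addSn addnS -(addn2 (s + s)) exprD [leRHS]mulrC ler_wpM2l// exprn_ge0.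
rewrite -(@ler_pXn2r _ 2)// ?nnegrE ?hits_ge0 ?exprn_ge0//.
rewrite -exprM muln2 -addnn (le_trans _ (even t))//.
rewrite -gsum_hits expr2.
apply: (@gsum_ge _ _ (fun x => hits R phi t x * hits R phi t x) g).
  by apply: fsuppMl; exact: fsupp_hits.
by move=> x; rewrite mulr_ge0 ?hits_ge0.
Qed.

End NormBound.

Lemma hits_exp_decay (R : realType) (D m m' : nat) (G : groupType)
    (phi : generators m G) (psi : generators m' G) :
  (1 < m)%N -> four_point_bound D psi -> ~ elementary G ->
  exists2 kappa : R, 1 <= kappa < (m.*2)%:R &
    forall t g, hits R phi t g <= kappa ^+ t.
Proof.
move=> m1 four nel.
have [f [e [h [h0 sh]]]] := superharmonic_exists four R nel.
have [kappa /andP[k1 kq] gap] := adjacency_gap phi m1 h0 sh.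
by exists kappa => [|t g]; [rewrite k1 | exact: hits_le].
Qed.

(** * Products of diverging elements *)

Section Transfer.
Variables (m m' : nat) (G : groupType).
Variables (phi : generators m G) (psi : generators m' G).
Implicit Types x y z g : G.

Lemma word_length_lipschitz : exists K, forall g,
  (word_length psi g <= K * word_length phi g)%N.
Proof.
exists (\sum_(a : letter m) word_length psi (phi [:: a]))%N => g.
have [w <- <-] := word_length_ex phi g.
elim: w => [|a w IH]; first by rewrite word_val_nil word_length1.
rewrite -cat1s word_val_cat (leq_trans (word_lengthM _ _ _))//= mulnS leq_add//.
by rewrite (bigD1 a)//= leq_addr.
Qed.

End Transfer.

(* A geodesic for [phi] is a quasi-geodesic for [psi], hence stays close to
   geodesics for [psi]. *)
Lemma gromov_product_transfer D m m' (G : groupType)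
    (phi : generators m G) (psi : generators m' G) :
  four_point_bound D psi -> exists K C, forall x y z,
  (vertex_dist phi x y + vertex_dist phi y z <= vertex_dist phi x z
    + (K * (vertex_dist psi x y + vertex_dist psi y z - vertex_dist psi x z) + C))%N.
Proof.
move=> four; have [K0 K0P] := word_length_lipschitz phi psi.
have [L LP] := word_length_lipschitz psi phi.
have [C0 C0P] := morse (vertex_distxx psi) (vertex_distC psi)
  (fun x y z => vertex_dist_triangle psi y x z) (@vertex_dist_geodesic _ _ psi) four K0 L.
(* A detour through [y] costs at most twice its [phi]-distance to the geodesic; this distance is at
   most [L] times the bound [2 * r + C0] of [morse]. *)
exists (4 * L)%N, (2 * L * C0)%N => x y z.
have [w wE sw] := word_length_ex phi (x^-1 * z)%g.
pose p i := (x * phi (take i w))%g.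
have p0 : p 0%N = x by rewrite /p take0 word_val_nil mulg1.
have pn : p (size w) = z by rewrite /p take_size wE mulVKg.
have seg i j : (i <= j <= size w)%N -> (vertex_dist phi (p i) (p j) <= j - i)%N.
  move=> /andP[ij jw]; rewrite /p vertex_distMl.
  have -> : take j w = take i w ++ drop i (take j w).
    by rewrite -{1}(cat_take_drop i (take j w)) take_takel.
  rewrite word_val_cat vertex_distMr (leq_trans (word_length_le _ _))//.
  by rewrite size_drop size_takel.
have dxz : vertex_dist phi x z = size w by rewrite sw.
have [|||i iw yi] := C0P p (size w) y
    (vertex_dist psi x y + vertex_dist psi y z - vertex_dist psi x z)%N.
- move=> j jw; apply: (leq_trans (K0P _)); rewrite -{2}(muln1 K0) leq_mul2l.
  by apply/orP; right; apply: (leq_trans (seg j j.+1 _)); rewrite ?leqnSn// subSnn.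
- move=> i j /andP[ij jw]; apply: (leq_trans _ (LP _)); rewrite -/(vertex_dist phi (p i) (p j)).
  have := seg 0%N i; have := seg j (size w); rewrite p0 pn jw leqnn (leq_trans ij jw).
  move=> /(_ isT) h1 /(_ isT) h2.
  have := vertex_dist_triangle phi (p i) x z; have := vertex_dist_triangle phi (p j) (p i) z.
  by rewrite dxz; lia.
- by rewrite p0 pn; lia.
have yphi : (vertex_dist phi y (p i) <= L * vertex_dist psi y (p i))%N by exact: LP.
have h : (L * vertex_dist psi y (p i) <= L * (2 * (vertex_dist psi x y
    + vertex_dist psi y z - vertex_dist psi x z) + C0))%N.
  by rewrite leq_mul2l yi orbT.
have := seg 0%N i; have := seg i (size w); rewrite p0 pn iw leqnn.
move=> /(_ isT) h1 /(_ isT) h2.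
have := vertex_dist_triangle phi (p i) x y; have := vertex_dist_triangle phi (p i) y z.
rewrite (vertex_distC phi (p i) y) dxz.
move: h; rewrite mulnDr mulnA; set r := (_ - vertex_dist psi x z)%N; nia.
Qed.

Section BasisWords.
Variables (G : groupType) (k : nat) (b : 'I_k -> G).
Implicit Types (v : word k) (a : letter k).

Definition basis_letter a : G := if a.2 then ((b a.1)^-1)%g else b a.1.

Lemma basis_letter_inv a : basis_letter (letter_inv a) = ((basis_letter a)^-1)%g.
Proof. by case: a => i [] //=; rewrite /basis_letter /= invgK. Qed.

Lemma basis_val_cat u v : basis_val b (u ++ v) = (basis_val b u * basis_val b v)%g.
Proof. by rewrite /basis_val big_cat. Qed.

Lemma basis_val1 a : basis_val b [:: a] = basis_letter a.
Proof. by rewrite /basis_val big_seq1. Qed.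

Lemma basis_val_inv v : basis_val b (word_inv v) = ((basis_val b v)^-1)%g.
Proof.
elim: v => [|a v IH]; first by rewrite /basis_val !big_nil invg1.
rewrite -cat1s word_inv_cat !basis_val_cat IH invgM !basis_val1.
by rewrite basis_letter_inv.
Qed.

Lemma not_reduced_cancel v : ~~ reduced v ->
  exists v1 a v2, v = v1 ++ [:: a; letter_inv a] ++ v2.
Proof.
elim: v => // a [|c v] IH //; rewrite /reduced /= negb_and negbK => /orP[/eqP ->|nr].
  by exists [::], a, v.
by have [v1 [a' [v2 ->]]] := IH nr; exists (a :: v1), a', v2.
Qed.

Lemma generated_reduced h : generated (range b) h ->
  exists2 v, reduced v & basis_val b v = h.
Proof.
move=> gh; have [v vh] : exists v, basis_val b v = h.
  apply: (gh [set x | exists v, basis_val b v = x]); split.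
    split => /=.
    - by exists [::]; rewrite /basis_val big_nil.
    - by move=> _ _ [u <-] [v <-]; exists (u ++ v); rewrite basis_val_cat.
    - by move=> _ [u <-]; exists (word_inv u); rewrite basis_val_inv.
  by move=> _ [i _ <-]; exists [:: (i, false)]; rewrite basis_val1.
have [n] := ubnP (size v); elim: n v vh => // n IH v vh vn.
have [rv|/not_reduced_cancel[v1 [a [v2 vE]]]] := boolP (reduced v); first by exists v.
apply: (IH (v1 ++ v2)).
  rewrite -vh vE !basis_val_cat (basis_val_cat [:: a]) !basis_val1 basis_letter_inv.
  by rewrite mulgV mul1g.
by move: vn; rewrite vE !size_cat /=; lia.
Qed.

Lemma reduced_rcons v a c : reduced (rcons (rcons v a) c) ->
  reduced (rcons v a) /\ c != letter_inv a.
Proof.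
rewrite /reduced; case: v => [|e v]; first by rewrite /= andbT.
by rewrite /= !rcons_path last_rcons => /andP[].
Qed.

End BasisWords.

(** When all letters are longer than [r + D], the four-point condition propagates along a reduced
    word: appending a letter loses at most [r + D] in [psi], hence at most [K * (r + D) + C] in
    [phi]. As each letter has [phi]-length at least [M.+1] times this loss, it contributes at least
    the fraction [M / M.+1] of its length. *)
Lemma chain_length D m m' (G : groupType)
    (phi : generators m G) (psi : generators m' G) M :
  four_point_bound D psi -> exists A B, forall k (b : 'I_k -> G) r,
  (forall a c : letter k, a != c ->
    (word_length psi (basis_letter b a) + word_length psi (basis_letter b c)
      <= vertex_dist psi (basis_letter b a) (basis_letter b c) + r)%N) ->
  (forall i, (A * r + B <= word_length psi (b i))%N) ->
  (forall i, (0 < word_length phi (b i))%N) /\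
  forall v, reduced v ->
    (M * (\sum_(a <- v) word_length phi (basis_letter b a))
      <= M.+1 * word_length phi (basis_val b v))%N.
Proof.
move=> four; have [K [C KC]] := gromov_product_transfer phi four.
have [Kp KpP] := word_length_lipschitz phi psi.
(* The products with [Kp] give the required [phi]-length after division by [Kp]; the remaining
   [r + D + 1] makes the [psi]-length exceed [r + D]. *)
exists (M.+1 * Kp * K + 1)%N, (M.+1 * Kp * (K * D + C) + D + 1)%N => k b r div long.
have longx a : ((M.+1 * Kp * K + 1) * r + (M.+1 * Kp * (K * D + C) + D + 1)
    <= word_length psi (basis_letter b a))%N.
  by case: a => i [] /=; rewrite /basis_letter /= ?word_lengthV; exact: long.
have pos g : (0 < word_length psi g)%N -> (0 < word_length phi g)%N.
  move=> h; rewrite lt0n; apply/eqP => h0; have := KpP g; rewrite h0 muln0.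
  by rewrite leqNgt h.
split=> [i|v].
  by apply: pos; apply: (leq_trans _ (long i)); lia.
have longphi a : (M.+1 * (K * (r + D) + C) <= word_length phi (basis_letter b a))%N.
  have Kp0 : (0 < Kp)%N.
    rewrite lt0n; apply/eqP => Kp0; have := KpP (basis_letter b a).
    by have := longx a; rewrite Kp0; lia.
  rewrite -(leq_pmul2l Kp0) (leq_trans _ (KpP _))// (leq_trans _ (longx a))//.
  move: (M.+1) => M1; rewrite mulnDl mul1n.
  have -> : (Kp * (M1 * (K * (r + D) + C)) = M1 * Kp * K * r + M1 * Kp * (K * D + C))%N.
    by ring.
  by lia.
have tail u a : reduced (rcons u a) ->
    (word_length psi (basis_val b u) + word_length psi (basis_letter b a)
      <= word_length psi (basis_val b u * basis_letter b a)%g + (r + D))%N.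
  elim/last_ind: u a => [|u c IH] a.
    by move=> _; rewrite /basis_val big_nil word_length1 mul1g; lia.
  move=> /reduced_rcons[/IH {}IH ac].
  set P := basis_val b u in IH; rewrite -cats1 basis_val_cat basis_val1 -/P.
  set P' := (P * basis_letter b c)%g in IH *.
  have f4 := four P 1%g (P' * basis_letter b a)%g P'.
  have dv : (word_length psi (basis_letter b c) + word_length psi (basis_letter b a)
      <= vertex_dist psi P (P' * basis_letter b a)%g + r)%N.
    have := div (letter_inv c) a; rewrite eq_sym ac => /(_ isT).
    by rewrite basis_letter_inv word_lengthV /P' -mulgA vertex_distMr /vertex_dist invgK.
  have e1 : vertex_dist psi P 1%g = word_length psi P by rewrite vertex_distC vertex_dist1l.
  have e2 : vertex_dist psi (P' * basis_letter b a)%g P' = word_length psi (basis_letter b a).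
    by rewrite vertex_distC vertex_distMr.
  have e3 : vertex_dist psi P P' = word_length psi (basis_letter b c) by rewrite vertex_distMr.
  rewrite !vertex_dist1l e1 e2 e3 in f4.
  have lc : (r + D < word_length psi (basis_letter b c))%N.
    by apply: (leq_trans _ (longx c)); rewrite mulnDl mul1n; lia.
  by move: f4; rewrite /maxn; case: ifP; lia.
elim/last_ind: v => [|u a IH]; first by rewrite big_nil muln0.
move=> rua.
have {}IH : (M * (\sum_(a <- u) word_length phi (basis_letter b a))
      <= M.+1 * word_length phi (basis_val b u))%N.
  by apply: IH; move: rua; rewrite /reduced; case: (u) => //= e w; rewrite rcons_path => /andP[].
have t := tail u a rua.
have := KC 1%g (basis_val b u) (basis_val b u * basis_letter b a)%g.
rewrite !vertex_dist1l !vertex_distMr => tphi.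
have {}tphi : (word_length phi (basis_val b u) + word_length phi (basis_letter b a)
   <= word_length phi (basis_val b u * basis_letter b a)%g + (K * (r + D) + C))%N.
  apply: (leq_trans tphi); rewrite leq_add2l leq_add2r leq_mul2l; apply/orP; right; lia.
rewrite -cats1 big_cat big_seq1 /= basis_val_cat basis_val1.
have := longphi a; move: tphi IH.
move: (word_length phi (basis_letter b a)) (\sum_(_ <- u) _)%N (word_length phi (basis_val b u)).
move: (word_length phi (basis_val b u * _)%g) (K * (r + D) + C)%N => q E x s p.
by rewrite !mulSn; nia.
Qed.

(** * Counting words *)

(** Padding shorter words with [None] makes [m.*2.+1] symbols; one more keeps the base at least 2
    for every [m]. *)
Lemma word_ball_enum_size m (G : groupType) (psi : generators m G) e :
  exists2 s : seq G, (size s <= (m.*2.+2) ^ e)%N &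
    forall x, (word_length psi x <= e)%N -> x \in s.
Proof.
exists [seq psi (pmap id (val t)) | t <- enum {: e.-tuple (option (letter m))}].
  rewrite size_map -cardE card_tuple card_option card_prod card_ord card_bool.
  by rewrite muln2; case: (e) => // e'; rewrite leq_exp2r.
move=> x xe; have [w wx sw] := word_length_ex psi x.
have te : size (map Some w ++ nseq (e - size w) None) == e.
  by rewrite size_cat size_map size_nseq subnKC// sw.
apply/mapP; exists (Tuple te); first by rewrite mem_enum.
rewrite /= pmap_cat map_pK// (_ : pmap id (nseq _ None) = [::]) ?cats0//.
by elim: (e - size w)%N.
Qed.

Section Counting.
Variables (R : realType) (D m m' : nat) (G : groupType).
Variables (phi : generators m G) (psi : generators m' G).
Variables (kappa : R) (K : nat).
Hypothesis kappa1 : 1 <= kappa < (m.*2)%:R.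
Hypothesis hitsP : forall t g, hits R phi t g <= kappa ^+ t.
Hypothesis four : four_point_bound D psi.
Hypothesis K0 : (0 < K)%N.
Hypothesis KP : forall g, (word_length psi g <= K * word_length phi g)%N.
Local Notation wl := (word_length psi).
Local Notation vd := (vertex_dist psi).
Local Notation q := ((m.*2)%:R : R).
Implicit Types (u v w : word m) (x y g : G).

Definition ball_base : R := (m'.*2.+2)%:R.
Local Notation Q := ball_base.
Local Notation tau := (kappa / q).

Lemma ball_base_ge2 : 2 <= Q.
Proof. by rewrite ler_nat. Qed.

Lemma ratio_lt1 : 0 < q /\ 0 < tau < 1.
Proof.
have q0 : 0 < q by move: kappa1; lra.
split => //; apply/andP; split; last by rewrite ltr_pdivrMr// mul1r; case/andP: kappa1.
by rewrite divr_gt0//; move: kappa1; lra.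
Qed.

Lemma kappaE : kappa = tau * q.
Proof. by have [q0 _] := ratio_lt1; rewrite divfK ?gt_eqF. Qed.

(** The ball contains words of all lengths [l <= n], while proportions are taken against [q ^+ n].
    As [tau * q = kappa >= 1], the missing [n - l] letters may be paid by [(tau * q) ^+ (n - l)]. *)
Lemma powers_le i l n : (i <= l)%N -> (l <= n)%N ->
  kappa ^+ i * q ^+ (l - i) <= tau ^+ (n - l + i) * q ^+ n.
Proof.
have [q0 /andP[t0 t1]] := ratio_lt1 => il ln.
have tq : 1 <= tau * q by rewrite -kappaE; case/andP: kappa1.
rewrite {1}kappaE exprMn -mulrA -exprD subnKC// addnC exprD -mulrA.
rewrite ler_wpM2l ?exprn_ge0 ?(ltW t0)//.
by rewrite -{2}(subnK ln) exprD mulrA -exprMn ler_peMl ?exprn_ege1// exprn_ge0 ?(ltW q0).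
Qed.

Definition count_words (P : pred (word m)) l : R :=
  \sum_(w <- words m l) (P w)%:R.

Lemma count_words_inv (P : pred (word m)) l :
  count_words (fun w => P (word_inv w)) l = count_words P l.
Proof. exact: (@big_words_inv m R (fun w => (P w)%:R)). Qed.

Lemma le_count_words (P P' : pred (word m)) l :
  (forall w, size w = l -> P w -> P' w) -> count_words P l <= count_words P' l.
Proof.
move=> PP'; rewrite /count_words !big_seq; apply: ler_sum => w.
rewrite mem_words => /eqP wsz; rewrite ler_nat.
by case: (P w) (PP' w wsz) => // ->.
Qed.

Lemma count_words_ex (I : Type) (r : seq I) (A : I -> pred (word m)) l :
  count_words (fun w => has (fun i => A i w) r) l <= \sum_(i <- r) count_words (A i) l.
Proof.
rewrite /count_words exchange_big/=; apply: ler_sum => w _.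
elim: r => [|i r IH] /=; first by rewrite big_nil.
rewrite big_cons; case: (A i w) => //=; last by rewrite add0r.
by rewrite lerDl sumr_ge0.
Qed.

Lemma sum_words_const c l : \sum_(w <- words m l) c = q ^+ l * c.
Proof.
rewrite big_const_seq count_predT size_words iter_addr_0 -[LHS]mulr_natl.
by rewrite natrX.
Qed.

Lemma count_prefix (P : pred (word m)) i l : (i <= l)%N ->
  count_words (fun w => P (take i w)) l = count_words P i * q ^+ (l - i).
Proof.
move=> il; rewrite /count_words -{1}(subnKC il) big_words_cat mulr_suml.
apply: eq_big_seq => u; rewrite mem_words => /eqP ui.
rewrite mulrC -sum_words_const; apply: eq_bigr => v _.
by rewrite take_size_cat.
Qed.

Lemma count_ball g e l :
  count_words (fun w => (vd g (phi w) <= e)%N) l <= Q ^+ e * kappa ^+ l.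
Proof.
have [s ss sP] := word_ball_enum_size psi e.
apply: (@le_trans _ _ (\sum_(x <- s) hits R phi l (g * x)%g)).
  rewrite /count_words /hits exchange_big/=; apply: ler_sum => w _.
  case: (boolP (vd g (phi w) <= e)%N) => [ge|_]; last by rewrite sumr_ge0.
  have xs := sP _ ge; rewrite (big_rem _ xs)/= mulVKg eqxx lerDl sumr_ge0//.
apply: (@le_trans _ _ (\sum_(x <- s) kappa ^+ l)); first exact: ler_sum.
rewrite big_const_seq count_predT iter_addr_0 -[leLHS]mulr_natl ler_wpM2r//.
  by rewrite exprn_ge0//; case/andP: kappa1; lra.
by rewrite -natrX ler_nat.
Qed.

Lemma count_short S l n : (l <= n)%N ->
  count_words (fun w => (wl (phi w) <= S)%N) l <= Q ^+ S * tau ^+ n * q ^+ n.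
Proof.
move=> ln; have := count_ball 1%g S l.
under [X in count_words X]eq_fun do rewrite vertex_dist1l.
move=> h; apply: (le_trans h); rewrite -mulrA ler_wpM2l ?exprn_ge0 ?ler0n//.
have := powers_le (leqnn l) ln; rewrite subnn expr0 mulr1 => /le_trans; apply.
by rewrite subnK.
Qed.

Lemma phi_length u : (wl (phi u) <= K * size u)%N.
Proof. by rewrite (leq_trans (KP _))// leq_mul2l word_length_le orbT. Qed.

Section Divergence.
(** The radius [e] comes from [path_near] for paths of length at most [2 ^ s], with one more [D] for
    moving to [[1, g]]; [rho] is the cut-off for Gromov products; a path needs at least [i0] letters
    to come within [e] of the sphere of radius [rho]. *)
Variables (s e rho i0 n : nat).
Hypothesis eP : (s.+1 * D + 2 * K <= e)%N.
Hypothesis ns : (n <= 2 ^ s)%N.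
Hypothesis i0P : (K * i0 + e <= rho)%N.

(* Words whose path follows the geodesic [1, g] along a distance [rho] have a
   prefix landing near the point of this geodesic at distance [rho]. *)
Lemma near_prefix g : (rho <= wl g)%N -> exists2 y, wl y = rho &
  forall w, (size w <= n)%N -> (vd g (phi w) + 2 * rho < wl g + wl (phi w))%N ->
  exists2 i, (i <= size w)%N & (vd y (phi (take i w)) <= e)%N.
Proof.
move=> rg; have := rg; rewrite -(vertex_dist1l psi) => /vertex_dist_geodesic[y []].
rewrite !vertex_dist1l => y1 y2; exists y => // w wn far.
pose x i := phi (take i w).
have x0 : x 0%N = 1%g by rewrite /x take0 word_val_nil.
have xn : x (0 + size w)%N = phi w by rewrite /x add0n take_size.
have step j : (0 <= j < 0 + size w)%N -> (vd (x j) (x j.+1) <= K)%N.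
  rewrite add0n => /andP[_ jw]; have [a0 _] : exists a : letter m, True.
    by case: (w) jw => // a; exists a.
  rewrite /x (take_nth a0 jw) -cats1 word_val_cat vertex_distMr.
  by rewrite (leq_trans (phi_length _))//= muln1.
have [i /andP[_ iw]] := path_near (vertex_distxx psi) (vertex_distC psi)
  (fun x y z => vertex_dist_triangle psi y x z) four y (leq_trans wn ns) step.
rewrite x0 xn add0n in iw *; rewrite !vertex_dist1l => near.
exists i => //; rewrite -/(x i).
have := four y 1%g (phi w) g.
rewrite (vertex_distC psi y 1%g) !vertex_dist1l (vertex_distC psi (phi w) g) y1 y2.
move: eP near far; rewrite mulSn y1 /maxn; case: ifP; lia.
Qed.

Lemma prefix_long y i w : wl y = rho -> (vd y (phi (take i w)) <= e)%N ->
  (i <= size w)%N -> (i0 <= i)%N.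
Proof.
move=> yr near iw; rewrite -(leq_pmul2l K0).
have := phi_length (take i w); rewrite size_takel//.
have := vertex_dist_triangle psi (phi (take i w)) y 1%g.
by rewrite !(vertex_distC psi _ 1%g) !vertex_dist1l yr; lia.
Qed.

(** Such a word has a prefix of some length [i >= i0] landing in the ball of radius [e] around a
    point depending only on [g]. At most [Q ^+ e * kappa ^+ i] prefixes do so, and [i] takes at most
    [n.+1] values. *)
Lemma count_pair g l : (l <= n)%N ->
  count_words (fun w => vd g (phi w) + 2 * rho < wl g + wl (phi w))%N l
   <= (n.+1)%:R * (Q ^+ e * tau ^+ i0) * q ^+ n.
Proof.
move=> ln; have [q0 /andP[t0 t1]] := ratio_lt1.
have Q0 : 0 <= Q by have := ball_base_ge2; lra.
have [rg|gr] := leqP rho (wl g); last first.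
  rewrite /count_words big1 => [|w _].
    by rewrite !mulr_ge0// ?exprn_ge0// ltW.
  apply/eqP; rewrite pnatr_eq0 eqb0 -leqNgt.
  by have := vertex_dist_triangle psi g 1%g (phi w); rewrite !vertex_dist1l; lia.
have [y yr yP] := near_prefix rg.
pose A i w := (i0 <= i)%N && (vd y (phi (take i w)) <= e)%N.
apply: (@le_trans _ _ (count_words (fun w => has (fun i => A i w) (iota 0 l.+1)) l)).
  apply: le_count_words => w wsz far; have [|i iw near] := yP w _ far; first by rewrite wsz.
  apply/hasP; exists i; first by rewrite mem_iota/= ltnS -wsz.
  by rewrite /A near (prefix_long yr near iw).
apply: (le_trans (count_words_ex _ _ _)).
apply: (@le_trans _ _ (\sum_(i <- iota 0 l.+1) Q ^+ e * tau ^+ i0 * q ^+ n)).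
  rewrite !big_seq; apply: ler_sum => i; rewrite mem_iota/= add0n ltnS => il.
  rewrite /A; case: (leqP i0 i) => [i0i|_]; last first.
    by rewrite /count_words big1// !mulr_ge0// ?exprn_ge0// ltW.
  rewrite /= (count_prefix (fun u => vd y (phi u) <= e)%N il).
  apply: (@le_trans _ _ (Q ^+ e * kappa ^+ i * q ^+ (l - i))).
    by rewrite ler_wpM2r ?exprn_ge0 ?count_ball// ltW.
  rewrite -!mulrA ler_wpM2l ?exprn_ge0//; apply: (le_trans (powers_le il ln)).
  rewrite ler_wpM2r ?exprn_ge0 ?(ltW q0)//.
  by apply: ler_wiXn2l; rewrite ?ltW// (leq_trans i0i)// leq_addl.
rewrite big_const_seq count_predT size_iota iter_addr_0 -[leLHS]mulr_natl -!mulrA.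
rewrite ler_wpM2r ?ler_nat//; by rewrite !mulr_ge0// ?exprn_ge0// ltW.
Qed.

Lemma count_prefix_short c i l : (i <= l)%N -> (l <= n)%N -> (l <= 2 * i)%N ->
  count_words (fun w => wl (phi (take i w)) <= c)%N l
    <= Q ^+ c * tau ^+ n./2 * q ^+ n.
Proof.
move=> il ln li; have [q0 /andP[t0 t1]] := ratio_lt1.
have Q0 : 0 <= Q by have := ball_base_ge2; lra.
rewrite (count_prefix (fun u => wl (phi u) <= c)%N il).
have := count_ball 1%g c i.
under [X in count_words X]eq_fun do rewrite vertex_dist1l.
move=> h; apply: (@le_trans _ _ (Q ^+ c * kappa ^+ i * q ^+ (l - i))).
  by rewrite ler_wpM2r ?exprn_ge0// ltW.
rewrite -!mulrA ler_wpM2l ?exprn_ge0//; apply: (le_trans (powers_le il ln)).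
rewrite ler_wpM2r ?exprn_ge0 ?(ltW q0)//.
by apply: ler_wiXn2l; rewrite ?ltW//; lia.
Qed.

(** Since [i + j <= l], the prefix and the suffix do not overlap: with the first [l - j] letters
    fixed, the inverse of the suffix has to land in a fixed ball. *)
Lemma count_opposite c i j l : (i + j <= l)%N -> (l <= n)%N ->
  count_words (fun w => vd (phi (take i w)) (phi (take j (word_inv w))) <= c)%N l
    <= Q ^+ c * tau ^+ j * q ^+ n.
Proof.
move=> ijl ln; have [q0 /andP[t0 t1]] := ratio_lt1.
have Q0 : 0 <= Q by have := ball_base_ge2; lra.
have jl : (j <= l)%N by lia.
have lE : l = (i + (l - i - j) + j)%N by lia.
rewrite /count_words {1}lE 2!big_words_cat.
apply: (@le_trans _ _ (\sum_(u <- words m i) \sum_(v <- words m (l - i - j)) Q ^+ c * kappa ^+ j)).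
  rewrite !big_seq; apply: ler_sum => u; rewrite mem_words => /eqP ui.
  rewrite !big_seq; apply: ler_sum => v; rewrite mem_words => /eqP vi.
  apply: le_trans (count_ball (phi u) c j).
  rewrite -count_words_inv /count_words; rewrite !big_seq; apply: ler_sum => t.
  rewrite mem_words => /eqP tj; rewrite ler_nat.
  by rewrite -catA take_size_cat// catA word_inv_cat take_size_cat// size_word_inv.
rewrite !sum_words_const mulrA -exprD mulrCA -mulrA ler_wpM2l ?exprn_ge0//.
rewrite mulrC (_ : i + (l - i - j) = l - j)%N; last by lia.
apply: (le_trans (powers_le jl ln)); rewrite ler_wpM2r ?exprn_ge0 ?(ltW q0)//.
by apply: ler_wiXn2l; rewrite ?ltW// leq_addl.
Qed.

(* If [w] and its inverse start alike, a prefix and the inverse of a suffix of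
   [w] are close; they cannot overlap unless one of them is short in the group
   although it covers half of [w]. *)
Lemma count_self l : (l <= n)%N ->
  count_words (fun w => vd (phi w) (phi w)^-1 + 2 * rho < wl (phi w) + wl (phi w)^-1)%N l
   <= (n.+1 * n.+1)%:R * (Q ^+ (2 * e) * tau ^+ i0) * q ^+ n
      + (2 * n.+1)%:R * (Q ^+ (rho + e) * tau ^+ n./2) * q ^+ n.
Proof.
move=> ln; have [q0 /andP[t0 t1]] := ratio_lt1.
have Q0 : 0 <= Q by have := ball_base_ge2; lra.
pose r := iota 0 l.+1.
pose A (ij : nat * nat) w := [&& (ij.1 + ij.2 <= l)%N, (i0 <= ij.2)%N &
  (vd (phi (take ij.1 w)) (phi (take ij.2 (word_inv w))) <= 2 * e)%N].
pose B i w := (l <= 2 * i)%N && (wl (phi (take i w)) <= rho + e)%N.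
pose P1 w := has (fun ij => A ij w) [seq (i, j) | i <- r, j <- r].
pose P2 w := has (fun i => B i w) r.
pose P3 w := has (fun i => B i (word_inv w)) r.
apply: (@le_trans _ _ (count_words P1 l + count_words P2 l + count_words P3 l)).
  rewrite /count_words -!big_split/= !big_seq; apply: ler_sum => w.
  rewrite mem_words => /eqP wsz.
  case: ltnP => [far|_]; last by rewrite !addr_ge0.
  suff : [|| P1 w, P2 w | P3 w].
    case/or3P=> ->; [rewrite -addrA lerDl | rewrite addrAC lerDr | rewrite lerDr];
      by rewrite addr_ge0.
  have rw : (rho <= wl (phi w)^-1)%N.
    by move: far; rewrite (word_lengthV psi (phi w)); lia.
  have [y yr yP] := near_prefix rw.
  have [||i iw yi] := yP w; [by rewrite wsz | by move: far; rewrite vertex_distC; lia|].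
  have [||j jw yj] := yP (word_inv w).
  - by rewrite size_word_inv wsz.
  - by rewrite word_val_inv vertex_distxx; move: far; rewrite (word_lengthV psi (phi w)); lia.
  rewrite size_word_inv in jw.
  have jl := prefix_long yr yj; rewrite size_word_inv in jl; have {}jl := jl jw.
  have len x : (vd y x <= e)%N -> (wl x <= rho + e)%N.
    have := vertex_dist_triangle psi y 1%g x.
    by rewrite !vertex_dist1l yr; lia.
  have ir : i \in r by rewrite mem_iota/= ltnS -wsz.
  have jr : j \in r by rewrite mem_iota/= ltnS -wsz.
  have [ijl|lij] := leqP (i + j) l.
    have close : (vd (phi (take i w)) (phi (take j (word_inv w))) <= 2 * e)%N.
      have := vertex_dist_triangle psi y (phi (take i w))
        (phi (take j (word_inv w))).
      by move: yi yj; rewrite (vertex_distC psi y (phi (take i w))); lia.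
    apply/orP; left; apply/hasP; exists (i, j); first exact: allpairs_f.
    by apply/and3P; split.
  have [li|il] := leqP l (2 * i).
    by apply/or3P/Or32; apply/hasP; exists i; rewrite // /B li len.
  by apply/or3P/Or33; apply/hasP; exists j; rewrite // /B len// andbT; lia.
have bnd2 : count_words P2 l <= (n.+1)%:R * (Q ^+ (rho + e) * tau ^+ n./2) * q ^+ n.
  apply: (le_trans (count_words_ex _ _ _)).
  apply: (@le_trans _ _ (\sum_(i <- r) Q ^+ (rho + e) * tau ^+ n./2 * q ^+ n)).
    rewrite !big_seq; apply: ler_sum => i; rewrite mem_iota/= add0n ltnS => il.
    rewrite /B; case: leqP => [li|_]; first exact: count_prefix_short.
    by rewrite /count_words big1// !mulr_ge0// ?exprn_ge0// ltW.
  rewrite big_const_seq count_predT size_iota iter_addr_0 -[leLHS]mulr_natl -!mulrA.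
  by rewrite ler_wpM2r ?ler_nat// !mulr_ge0// ?exprn_ge0// ltW.
have bnd3 : count_words P3 l = count_words P2 l by exact: (count_words_inv P2).
have bnd1 : count_words P1 l <= (n.+1 * n.+1)%:R * (Q ^+ (2 * e) * tau ^+ i0) * q ^+ n.
  apply: (le_trans (count_words_ex _ _ _)).
  apply: (@le_trans _ _ (\sum_(ij <- [seq (i, j) | i <- r, j <- r]) Q ^+ (2 * e) * tau ^+ i0 * q ^+ n)).
    apply: ler_sum => -[i j] _.
    rewrite /A /=; case: leqP => [ijl|_] /=; last first.
      by rewrite /count_words big1// !mulr_ge0// ?exprn_ge0// ltW.
    case: leqP => [i0j|_] /=; last first.
      by rewrite /count_words big1// !mulr_ge0// ?exprn_ge0// ltW.
    apply: (le_trans (count_opposite _ ijl ln)).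
    rewrite ler_wpM2r ?exprn_ge0 ?(ltW q0)// ler_wpM2l ?exprn_ge0//.
    by apply: ler_wiXn2l; rewrite ?ltW.
  rewrite big_const_seq count_predT size_allpairs size_iota iter_addr_0 -[leLHS]mulr_natl -!mulrA.
  by rewrite ler_wpM2r ?ler_nat ?leq_mul// !mulr_ge0// ?exprn_ge0// ltW.
rewrite bnd3 -addrA lerD// mulnC natrM; move: bnd2; lra.
Qed.

End Divergence.
End Counting.

(** * Exponential decay *)

Lemma bernoulli (R : realType) (x : R) n : -1 <= x -> 1 + n%:R * x <= (1 + x) ^+ n.
Proof.
move=> x1; elim: n => [|n IH]; first by rewrite mul0r addr0.
rewrite exprS; have : (1 + x) * (1 + n%:R * x) <= (1 + x) * (1 + x) ^+ n.
  by rewrite ler_wpM2l//; lra.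
apply: le_trans; rewrite -natr1; have : 0 <= n%:R :> R by []; have := sqr_ge0 x.
by move: (n%:R : R) => N; nra.
Qed.

Lemma root_above (R : realType) (tau : R) T : 0 < tau < 1 -> (0 < T)%N ->
  exists2 alpha, 0 < alpha < 1 & tau <= alpha ^+ T.
Proof.
move=> /andP[t0 t1] T0; have T1 : 1 <= T%:R :> R by rewrite ler1n.
pose x := (1 - tau) / T%:R.
have x0 : 0 < x by rewrite divr_gt0//; lra.
have x1 : x < 1 by rewrite ltr_pdivrMr; lra.
exists (1 - x); first by apply/andP; lra.
have x2 : -1 <= - x by lra.
apply: (le_trans _ (bernoulli T x2)); rewrite mulrN mulrC divfK ?gt_eqF//; lra.
Qed.

Lemma power_below (R : realType) (tau Q : R) : 0 < tau < 1 ->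
  exists J, Q * tau ^+ J <= 1.
Proof.
move=> /andP[t0 t1]; pose x := tau^-1 - 1.
have x0 : 0 < x by rewrite subr_gt0 invf_gt1.
have [J JP] : exists J : nat, Q <= J%:R * x.
  exists (Num.bound `|Q / x|); rewrite -ler_pdivrMr//.
  exact: le_trans (ler_norm _) (ltW (archi_boundP (normr_ge0 _))).
exists J; rewrite -ler_pdivlMr ?exprn_gt0// mul1r -exprVn.
have := @bernoulli R x J; rewrite (_ : 1 + x = tau^-1); last by rewrite /x; lra.
by move=> /(_ ltac:(lra)); lra.
Qed.

(** Distribution of the exponents of [tau], with [rho = n %/ T] and [i0] close to [rho / K]. The
    rate [y = n %/ U] is about a quarter of [i0], and [T >= 8 * JA] keeps [JA * rho] below [n / 8].
    The [J] terms are the exponents spent on powers of [Q]. *)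
Lemma tail_parameters_aux (K T U C n e Jz JA JB b : nat) :
  (0 < K)%N -> T = (8 * JA + 8)%N -> U = (4 * (T * K))%N ->
  (C + 4 * T + 2 * U + 32 * JB + 64 <= n)%N ->
  b = (K * Jz + e)%N -> (4 * (T * b) <= n + C)%N ->
  exists i0 y, [/\ (K * i0 + e <= n %/ T)%N, (y + Jz <= i0)%N,
    (y + Jz + JA * (n %/ T) + JB <= n./2)%N & (n <= 2 * U * y)%N].
Proof.
move=> K0 TE UE nN bE bn.
have T0 : (0 < T)%N by rewrite TE addn_gt0 orbT.
have U0 : (0 < U)%N by rewrite UE !muln_gt0 T0 K0.
have r1 : (n %/ T * T <= n)%N := leq_divM _ _.
have r2 : (n < (n %/ T).+1 * T)%N := ltn_ceil n T0.
have y1 : (n %/ U * U <= n)%N := leq_divM _ _.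
have y2 : (n < (n %/ U).+1 * U)%N := ltn_ceil n U0.
have i1 : ((n %/ T - e) %/ K * K <= n %/ T - e)%N := leq_divM _ _.
have i2 : (n %/ T - e < ((n %/ T - e) %/ K).+1 * K)%N := ltn_ceil _ K0.
exists ((n %/ T - e) %/ K)%N, (n %/ U)%N.
move: (n %/ T)%N (n %/ U)%N ((_ - e) %/ K)%N r1 r2 y1 y2 i1 i2 => rho y i0 r1 r2 y1 y2 i1 i2.
have h a x : (a <= x -> T * a <= T * x)%N by move=> ax; rewrite leq_mul2l ax orbT.
rewrite mulnC in r1; rewrite mulSn mulnC in r2; rewrite mulSn mulnC in y2.
rewrite mulnC in y1; rewrite mulnC in i1; rewrite mulSn mulnC in i2.
have yT : (4 * (T * (K * y)) <= n)%N.
  by move: y1; rewrite UE -!mulnA.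
have er : (e <= rho)%N.
  rewrite leqNgt; apply/negP => re.
  have : (T * rho <= T * b)%N by apply: h; rewrite bE; move: re; clear; lia.
  by move: r2 bn nN; clear; lia.
have yi : (y + Jz <= i0)%N.
  rewrite leqNgt; apply/negP => lt.
  have : (K * i0.+1 <= K * (y + Jz))%N by rewrite leq_mul2l lt orbT.
  rewrite mulnS mulnDr => h1.
  have /h : (rho + 1 <= K * y + b)%N by rewrite bE; move: h1 i2 er; clear; lia.
  by rewrite !mulnDr muln1; move: r2 bn nN yT; clear; lia.
split => //.
- by move: i1 er; clear; lia.
- have h1 : (8 * y <= n)%N.
    apply: leq_trans yT; rewrite mulnA leq_mul ?leq_pmull//.
    by rewrite TE; clear; lia.
  have h2 : (32 * Jz <= n + C)%N.
    apply: leq_trans bn; rewrite mulnA leq_mul//; first by rewrite TE; clear; lia.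
    by rewrite bE (leq_trans (leq_pmull Jz K0))// leq_addr.
  have h3 : (8 * (JA * rho) <= n)%N.
    by apply: leq_trans r1; rewrite mulnA leq_mul2r TE leq_addr orbT.
  by have := odd_double_half n; move: nN h1 h2 h3; clear; lia.
- by move: y2 nN; rewrite -mulnA; clear; lia.
Qed.

(** With [Q * tau ^+ J <= 1], every factor [Q] is paid by [J] factors [tau]. The polynomial factors
    are [Q] to a logarithmic power, and [Q ^+ (A * (n %/ T) + B)] is paid out of [tau ^+ n./2]
    because [T] is large. There remains [tau ^+ y] with [y] linear in [n]. *)
Lemma tail_exponential (R : realType) (Q tau : R) (D K c A B : nat) :
  2 <= Q -> 0 < tau < 1 -> (0 < K)%N ->
  exists T, exists2 alpha, 0 < alpha < 1 & exists N, forall n, (N <= n)%N ->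
    let s := up_log 2 n.+1 in let e := (s.+1 * D + 2 * K)%N in
    exists2 i0, (K * i0 + e <= n %/ T)%N &
    c%:R * ((n.+1)%:R ^+ 3 * Q ^+ (2 * e)
      * (tau ^+ i0 + 2 * (Q ^+ (A * (n %/ T) + B) * tau ^+ n./2))) <= alpha ^+ n.
Proof.
move=> Q2 tau01 K0; have /andP[t0 t1] := tau01.
have Q0 : 0 <= Q by lra. have Q1 : 1 <= Q by lra.
have [J QJ] := power_below Q tau01.
have [T TE] : exists T, T = (8 * (J * A) + 8)%N by eexists.
have T0 : (0 < T)%N by rewrite TE addn_gt0 orbT.
have [U UE] : exists U, U = (4 * (T * K))%N by eexists.
have U0 : (0 < U)%N by rewrite UE !muln_gt0 T0 K0.
have [alpha a01 aP] := @root_above R tau (2 * U) tau01 ltac:(by rewrite muln_gt0).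
exists T, alpha => //.
have [b1 b1E] : exists b, b = (K * J * (3 + 2 * D) + D)%N by eexists.
have [b2 b2E] : exists b, b = (K * J * (2 * D + 4 * K + c + 2) + D + 2 * K)%N by eexists.
have [C0 logC] := up_log2_sublinear (4 * T * b1)%N.
have [C CE] : exists C, C = (C0 + 1 + 4 * T * b2)%N by eexists.
exists (C + 4 * T + 2 * U + 32 * (J * B) + 64)%N => n nN s e.
(* The exponent [z] covers [(n.+1) ^+ 3 <= Q ^+ (3 * s)], [Q ^+ (2 * e)], [c <= Q ^+ c], and
   [3 <= Q ^+ 2] for the three terms of the sum. *)
pose z := (3 * s + 2 * e + c + 2)%N; pose S := (A * (n %/ T) + B)%N.
have bn : (4 * (T * (K * (J * z) + e)) <= n + C)%N.
  have -> : (K * (J * z) + e = b1 * s + b2)%N by rewrite /z /e b1E b2E mulSn; ring.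
  rewrite mulnA mulnDr mulnA CE; have := logC n.+1; rewrite -/s.
  by move: (4 * T * b1 * s)%N (4 * T * b2)%N; clear; lia.
have [i0 [y [Ki0 yi yh ny]]] := tail_parameters_aux K0 TE UE nN erefl bn.
have {}yh : (y + J * (z + S) <= n./2)%N.
  have -> : (y + J * (z + S) = y + J * z + J * A * (n %/ T) + J * B)%N by rewrite /S; ring.
  exact: yh.
exists i0 => //; rewrite -/S.
have absorb i k : (y + J * k <= i)%N -> Q ^+ k * tau ^+ i <= tau ^+ y.
  move=> le.
  have -> : Q ^+ k * tau ^+ i = tau ^+ y * ((Q * tau ^+ J) ^+ k * tau ^+ (i - (y + J * k))).
    by rewrite -{1}(subnKC le) !exprD exprM exprMn; ring.
  have tn0 l : 0 <= tau ^+ l by rewrite exprn_ge0// ltW.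
  have q0 : 0 <= Q * tau ^+ J by rewrite mulr_ge0.
  apply: ler_piMr => //; apply: mulr_ile1; rewrite ?tn0 ?exprn_ge0//.
    by rewrite exprn_ile1.
  by rewrite exprn_ile1// ltW.
have pre : c%:R * ((n.+1)%:R ^+ 3 * Q ^+ (2 * e)) * 3 <= Q ^+ z.
  have c1 : c%:R <= Q ^+ c.
    have := @bernoulli R (Q - 1) c ltac:(lra); rewrite (_ : 1 + (Q - 1) = Q); last lra.
    have : 0 <= c%:R :> R by []; move: (Q ^+ c) (c%:R : R) => u v; nra.
  have n1 : (n.+1)%:R <= Q ^+ s.
    apply: (@le_trans _ _ (2 ^+ s)); last by apply: lerXn2r; rewrite ?nnegrE.
    by rewrite -natrX ler_nat; exact: up_logP.
  have -> : z = (c + (s * 3 + 2 * e) + 2)%N by rewrite /z; move: (e) (s); clear; lia.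
  rewrite 3!exprD [Q ^+ (s * 3)]exprM.
  have e0 : 0 <= Q ^+ (2 * e) by rewrite exprn_ge0.
  have n0 : 0 <= (n.+1)%:R ^+ 3 :> R by rewrite exprn_ge0.
  have n3 : (n.+1)%:R ^+ 3 <= (Q ^+ s) ^+ 3.
    by apply: lerXn2r; rewrite ?nnegrE ?exprn_ge0.
  have Q3 : 3 <= Q ^+ 2 by rewrite expr2; nra.
  apply: ler_pM => //; first by rewrite !mulr_ge0.
  by apply: ler_pM; rewrite ?mulr_ge0// ler_wpM2r.
apply: (@le_trans _ _ (tau ^+ y)).
  have z1 := absorb i0 z yi; have z2 := absorb n./2 (z + S)%N yh.
  rewrite exprD -mulrA in z2.
  set X := tau ^+ i0 in z1 *; set Y := Q ^+ S * tau ^+ n./2 in z2 *.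
  have X0 : 0 <= X by rewrite exprn_ge0// ltW.
  have Y0 : 0 <= Y by rewrite mulr_ge0 ?exprn_ge0// ltW.
  rewrite (mulrA c%:R); set P := c%:R * _ in pre *.
  have := le_trans (ler_wpM2r X0 pre) z1; have := le_trans (ler_wpM2r Y0 pre) z2.
  by move: P X Y (tau ^+ y) {pre z1 z2 X0 Y0} => P X Y t; lra.
apply: (@le_trans _ _ (alpha ^+ (2 * U * y))).
  by rewrite exprM lerXn2r// ?nnegrE ?exprn_ge0// ?ltW//; case/andP: a01.
case/andP: a01 => a0 a1; apply: ler_wiXn2l; rewrite ?ltW//.
Qed.

(** * Tuples of words *)

Section TupleCounting.
Variables (R : realType) (m k n : nat).
Local Notation T := (n.-bseq (letter m)).
Local Notation F := {ffun 'I_k -> T}.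

Definition tuple_of_ffun (t : F) : k.-tuple (word m) := [tuple (t i : word m) | i < k].

Lemma tuple_of_ffun_inj : injective tuple_of_ffun.
Proof.
move=> t t' tt'; apply/ffunP => i; apply: val_inj => /=.
by have := congr1 (fun w => tnth w i) tt'; rewrite !tnth_mktuple.
Qed.

Lemma card_word_ball_sub (X : set (k.-tuple (word m))) :
  #|` fset_set (X `&` @word_ball m k n)| = #|[pred t : F | `[< X (tuple_of_ffun t) >]]|.
Proof.
set S := [pred t : F | _].
have -> : fset_set (X `&` @word_ball m k n) = [fset w in map tuple_of_ffun (enum S)]%fset.
  apply/fsetP => w; rewrite in_fset_set; last first.
    by apply: sub_finite_set (@finite_word_ball m k n) => x [].
  rewrite inE/=; apply/idP/idP.
    rewrite inE => -[Xw wn]; have wE : tuple_of_ffun [ffun i => Bseq (wn i)] = w.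
      by apply: eq_from_tnth => i; rewrite tnth_mktuple ffunE.
    apply/mapP; exists [ffun i => Bseq (wn i)]; last by rewrite wE.
    by rewrite mem_enum unfold_in /= wE; exact/asboolP.
  case/mapP => t; rewrite mem_enum unfold_in => /asboolP Xt ->; rewrite inE; split => //.
  by move=> i; rewrite tnth_mktuple; exact: size_bseq.
rewrite card_fseq undup_id ?size_map -?cardE//.
by rewrite map_inj_uniq ?enum_uniq//; exact: tuple_of_ffun_inj.
Qed.

Lemma generic_defect (X : set (k.-tuple (word m))) (P : pred F) :
  (forall t, ~ X (tuple_of_ffun t) -> P t) -> (0 < #|F|)%N ->
  `|1 - #|` fset_set (X `&` @word_ball m k n)|%:R / #|` fset_set (@word_ball m k n)|%:R|
    <= #|P|%:R / #|F|%:R :> R.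
Proof.
move=> XP F0; rewrite -{2}(setTI (@word_ball m k n)) !card_word_ball_sub.
have -> : #|[pred t : F | `[< [set: k.-tuple (word m)] (tuple_of_ffun t) >]]| = #|F|.
  by apply: eq_card => t; rewrite !inE; apply/asboolP.
set S := [pred t : F | _].
have cS : (#|S| + #|[predC S]| = #|F|)%N by exact: cardC.
have cP : (#|[predC S]| <= #|P|)%N.
  by apply/subset_leq_card/fintype.subsetP => t; rewrite !inE => /asboolP; exact: XP.
have F1 : 0 < #|F|%:R :> R by rewrite ltr0n.
have -> : 1 - #|S|%:R / #|F|%:R = #|[predC S]|%:R / #|F|%:R :> R.
  by apply: (mulIf (lt0r_neq0 F1)); rewrite mulrBl mul1r !divfK ?lt0r_neq0// -cS natrD addrAC subrr add0r.
by rewrite ger0_norm ?divr_ge0// ler_pM2r ?invr_gt0// ler_nat.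
Qed.

Definition update (t : F) (j : 'I_k) (v : T) : F := [ffun i => if i == j then v else t i].

(** Conditioning on all coordinates but [j]: exchanging the coordinate [t j] with a fresh word [v]
    is an involution on the pairs [(t, v)], so resampling preserves the count. *)
Lemma count_update (P : pred F) (j : 'I_k) (N : R) :
  (forall t, \sum_(v : T) (P (update t j v))%:R <= N) ->
  #|P|%:R * #|{: T}|%:R <= N * #|F|%:R.
Proof.
move=> PN.
have -> : #|P|%:R * #|{: T}|%:R = \sum_(t : F) \sum_(v : T) (P t)%:R :> R.
  rewrite -sum1_card natr_sum mulr_suml [RHS](bigID P)/= [X in _ + X]big1 ?addr0.
    by apply: eq_bigr => t Pt; rewrite sumr_const (idP Pt : P t = true) mul1r.
  by move=> t /negPf ->; rewrite big1.
have -> : \sum_(t : F) \sum_(v : T) (P t)%:R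
    = \sum_(t : F) \sum_(v : T) (P (update t j v))%:R :> R.
  rewrite !pair_big/=.
  pose h (p : F * T) := (update p.1 j p.2, p.1 j).
  have hK : involutive h.
    move=> [t v]; rewrite /h /=; congr pair; last by rewrite ffunE eqxx.
    by apply/ffunP => i; rewrite !ffunE; case: eqP => [->|].
  by rewrite (reindex_inj (inv_inj hK)).
apply: (le_trans (ler_sum _ (fun t _ => PN t))).
by rewrite sumr_const mulr_natr.
Qed.

Lemma big_bseq (f : word m -> R) :
  \sum_(v : T) f v = \sum_(l <- iota 0 n.+1) \sum_(w <- words m l) f w.
Proof.
have -> : \sum_(l <- iota 0 n.+1) \sum_(w <- words m l) f w
    = \sum_(w <- [seq w | l <- iota 0 n.+1, w <- words m l]) f w.
  by rewrite big_allpairs_dep.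
rewrite -(big_map (fun v : T => v : word m) predT f).
apply: perm_big; apply: uniq_perm.
- by rewrite map_inj_uniq ?index_enum_uniq//; exact: val_inj.
- apply: allpairs_uniq_dep => //; first exact: iota_uniq.
    by move=> l _; exact: uniq_words.
  move=> [l w] [l' w'] /allpairsPdep[a [b [_ + [-> ->]]]] /allpairsPdep[c [d [_ + [-> ->]]]] /=.
  by rewrite !mem_words => /eqP <- /eqP <- ->.
move=> w; apply/mapP/allpairsPdep => [[v _ ->]|[l [u [ln + ->]]]].
  by exists (size v), (v : word m); split; rewrite ?mem_words// mem_iota/= ltnS size_bseq.
rewrite mem_words => /eqP ul; have un : (size u <= n)%N.
  by rewrite ul; move: ln; rewrite mem_iota/= ltnS.
by exists (Bseq un) => //; rewrite mem_index_enum.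
Qed.

Lemma card_bseq_ge : (m.*2)%:R ^+ n <= #|{: T}|%:R :> R.
Proof.
have -> : #|{: T}|%:R = \sum_(v : T) 1 :> R by rewrite sumr_const.
rewrite (big_bseq (fun=> 1)) (bigD1_seq n) ?iota_uniq ?mem_iota//=.
by rewrite sum_words_const mulr1 lerDl sumr_ge0// => l _; rewrite sumr_ge0.
Qed.

Lemma density_le (P : pred F) (j : 'I_k) (E : R) : (0 < m)%N -> 0 <= E ->
  (forall t, exists2 Pw : pred (word m), (forall v, P (update t j v) = Pw v) &
     forall l, (l <= n)%N -> count_words R Pw l <= E * (m.*2)%:R ^+ n) ->
  #|P|%:R <= (n.+1)%:R * E * #|F|%:R.
Proof.
move=> m0 E0 h; have q0 : 0 < (m.*2)%:R ^+ n :> R by rewrite exprn_gt0// ltr0n double_gt0.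
have T0 : 0 < #|{: T}|%:R :> R := lt_le_trans q0 card_bseq_ge.
rewrite -(ler_pM2r T0); apply: (le_trans (@count_update P j ((n.+1)%:R * E * #|{: T}|%:R) _)); last first.
  by rewrite -!mulrA (mulrC #|F|%:R).
move=> t; have [Pw PwE cP] := h t.
under eq_bigr do rewrite PwE.
rewrite (big_bseq (fun w => (Pw w)%:R)).
apply: (@le_trans _ _ (\sum_(l <- iota 0 n.+1) E * (m.*2)%:R ^+ n)).
  rewrite !big_seq; apply: ler_sum => l; rewrite mem_iota/= ltnS; exact: cP.
rewrite big_const_seq count_predT size_iota iter_addr_0 -[leLHS]mulr_natl -mulrA.
by rewrite ler_wpM2l// ler_wpM2l// card_bseq_ge.
Qed.

End TupleCounting.

Lemma exp_generic_sub (R : realType) m k (X Y : set (k.-tuple (word m))) :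
  X `<=` Y -> exp_generic R X -> exp_generic R Y.
Proof.
move=> XY [alpha a01 [N NP]]; exists alpha => //; exists N => n /NP.
apply: le_trans; pose c := #|` fset_set (@word_ball m k n)|.
have fin Z : finite_set (Z `&` @word_ball m k n).
  by apply: sub_finite_set (@finite_word_ball m k n) => x [].
have le1 : (#|` fset_set (X `&` @word_ball m k n)| <= #|` fset_set (Y `&` @word_ball m k n)|)%N.
  apply/fsubset_leq_card/fsubsetP => x; rewrite !in_fset_set//; try exact: fin.
  by rewrite !inE => -[/XY].
have le2 : (#|` fset_set (Y `&` @word_ball m k n)| <= c)%N.
  apply/fsubset_leq_card/fsubsetP => x; rewrite !in_fset_set//; try exact: fin.
    by rewrite !inE => -[].
  exact: finite_word_ball.
rewrite -/c in le2 *; have [->|c0] := posnP c; first by rewrite invr0 !mulr0.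
have c1 : 0 < c%:R :> R by rewrite ltr0n.
have le3 : #|` fset_set (Y `&` @word_ball m k n)|%:R / c%:R <= 1 :> R.
  by rewrite ler_pdivrMr// mul1r ler_nat.
have le4 : #|` fset_set (X `&` @word_ball m k n)|%:R / c%:R
    <= #|` fset_set (Y `&` @word_ball m k n)|%:R / c%:R :> R.
  by rewrite ler_pM2r ?invr_gt0// ler_nat.
by rewrite !ger0_norm; lra.
Qed.

(* [r] bounds the doubled Gromov products of the letters [b_i^{+-1}]. *)
Definition diverging m m' (G : groupType) (phi : generators m G)
    (psi : generators m' G) (A B k : nat) (w : k.-tuple (word m)) :=
  exists r, let b i := phi (tnth w i) in
  (forall a c : letter k, a != c ->
    (word_length psi (basis_letter b a) + word_length psi (basis_letter b c)
      <= vertex_dist psi (basis_letter b a) (basis_letter b c) + r)%N) /\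
  (forall i, (A * r + B <= word_length psi (b i))%N).

(** Union bound over [k] events that a word is short and at most [(2k)^2] events that two distinct
    letters have a large Gromov product. In each, only one word is resampled: two different words
    are handled by [count_pair], a word and its inverse by [count_self]. *)
Lemma diverging_generic (R : realType) (D m m' : nat) (G : groupType)
    (phi : generators m G) (psi : generators m' G) (A B k : nat) :
  (1 < m)%N -> four_point_bound D psi -> ~ elementary G ->
  exp_generic R [set w : k.-tuple (word m) | diverging phi psi A B w].
Proof.
move=> m1 four nel.
have [kappa k1 hitsP] := hits_exp_decay R phi m1 four nel.
have [K KP'] := word_length_lipschitz phi psi.
have KP g : (word_length psi g <= K.+1 * word_length phi g)%N.
  by rewrite (leq_trans (KP' g))// leq_mul2r leqnSn orbT.
have [q0 tau01] := ratio_lt1 k1; have /andP[t0 t1] := tau01.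
set tau := kappa / _ in tau01 t0 t1.
pose c := (k + (k * 2) * (k * 2))%N.
(* With [r = 2 * rho], the lengths must reach [2 * A * rho + B]; the additional [rho] absorbs the
   ball of radius [rho + e] of [count_self]. *)
have [T [alpha a01 [N NP]]] := @tail_exponential R (ball_base R m') tau D K.+1 c
  (2 * A + 1) B (ball_base_ge2 R m') tau01 isT.
exists alpha => //; exists N => n nN.
have [i0 Ki0 bound] := NP n nN.
set s := up_log 2 n.+1 in Ki0 bound; set e := (s.+1 * D + 2 * K.+1)%N in Ki0 bound.
set rho := (n %/ T)%N in Ki0 bound; set S := ((2 * A + 1) * rho + B)%N in bound.
set Q := ball_base R m' in bound.
have Q2 : 2 <= Q := ball_base_ge2 R m'.
have Q0 : 0 <= Q by lra. have Q1 : 1 <= Q by lra.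
pose b (t : {ffun 'I_k -> n.-bseq (letter m)}) (i : 'I_k) := phi (t i).
pose x t (a : letter k) := basis_letter (b t) a.
pose short i t := (word_length psi (b t i) <= S)%N.
pose close a c t := (vertex_dist psi (x t a) (x t c) + 2 * rho
  < word_length psi (x t a) + word_length psi (x t c))%N.
pose bad t := [exists i, short i t] || [exists a, exists c, (a != c) && close a c t].
have m0 : (0 < m)%N by rewrite ltnW.
have ns : (n <= 2 ^ s)%N by rewrite (leq_trans (leqnSn n))// up_logP.
have [M ME] : exists M : R, M = (n.+1)%:R ^+ 2 * Q ^+ (2 * e) * (tau ^+ i0 + 2 * (Q ^+ S * tau ^+ n./2)).
  by eexists.
have n1 : 1 <= (n.+1)%:R :> R by rewrite ler1n.
have tn j : 0 <= tau ^+ j by rewrite exprn_ge0// ltW.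
have Qn j : 1 <= Q ^+ j by rewrite exprn_ege1.
have Y0 : 0 <= Q ^+ S * tau ^+ n./2 by rewrite mulr_ge0// exprn_ge0.
have X0 := tn i0.
have M0 : 0 <= M by rewrite ME !mulr_ge0 ?exprn_ge0// addr_ge0// mulr_ge0.
have shortP i : #|[pred t | short i t]|%:R
    <= (n.+1)%:R * M * #|{ffun 'I_k -> n.-bseq (letter m)}|%:R :> R.
  apply: (@density_le R m k n _ i M m0 M0) => t.
  exists (fun w => word_length psi (phi w) <= S)%N.
    by move=> v; rewrite /= /short /b ffunE eqxx.
  move=> l ln; apply: (le_trans (count_short psi k1 hitsP S ln)).
  rewrite ler_wpM2r ?exprn_ge0 ?(ltW q0)// -/Q -/tau ME.
  apply: (@le_trans _ _ (Q ^+ S * tau ^+ n./2)).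
    rewrite ler_wpM2l ?exprn_ge0//; apply: ler_wiXn2l; rewrite ?ltW//.
    by rewrite -divn2 leq_div.
  have : 1 * 1 <= (n.+1)%:R ^+ 2 * Q ^+ (2 * e).
    by apply: ler_pM => //; rewrite exprn_ege1.
  rewrite mul1r; move: (_ * Q ^+ (2 * e)) (Q ^+ S * _) (tau ^+ i0) Y0 X0 => u v y.
  by clear; nra.
have pairP a a' : a != a' -> #|[pred t | close a a' t]|%:R
    <= (n.+1)%:R * M * #|{ffun 'I_k -> n.-bseq (letter m)}|%:R :> R.
  move=> aa'; apply: (@density_le R m k n _ a'.1 M m0 M0) => t.
  have [ij|ij] := eqVneq a.1 a'.1; last first.
    exists (fun w => (vertex_dist psi (x t a) (phi (if a'.2 then word_inv w else w)) + 2 * rho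
       < word_length psi (x t a) + word_length psi (phi (if a'.2 then word_inv w else w)))%N).
      move=> v; rewrite /= /close /x /basis_letter /b !ffunE (negPf ij) eqxx.
      by case: a'.2; rewrite ?word_val_inv.
    move=> l ln; pose P w := (vertex_dist psi (x t a) (phi w) + 2 * rho
       < word_length psi (x t a) + word_length psi (phi w))%N.
    have h := count_pair k1 hitsP four (ltn0Sn K) KP (leqnn _) ns Ki0 (x t a) ln.
    apply: (@le_trans _ _ (count_words R P l)).
      by case: a'.2 => //; rewrite -(count_words_inv R P).
    apply: (le_trans h); rewrite ler_wpM2r ?exprn_ge0 ?(ltW q0)// -/Q -/tau ME.
    have : (n.+1)%:R * Q ^+ e <= (n.+1)%:R ^+ 2 * Q ^+ (2 * e).
      apply: ler_pM => //; first by rewrite exprn_ge0.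
        by rewrite expr2; move: (n.+1%:R : R) n1 => u; nra.
      by rewrite ler_weXn2l// mul2n -addnn leq_addr.
    have : 0 <= (n.+1)%:R ^+ 2 * Q ^+ (2 * e) by rewrite mulr_ge0// exprn_ge0.
    rewrite mulrA; move: (_ * Q ^+ (2 * e)) (_ * Q ^+ e) (Q ^+ S * _) (tau ^+ i0) Y0 X0 => u w v y.
    by clear; nra.
  have a'E : a' = letter_inv a.
    move: a a' ij aa' => [i s1] [j s2] /= ij; rewrite -ij => ne; congr pair.
    by case: s1 s2 ne => -[]; rewrite ?eqxx.
  exists (fun w => (vertex_dist psi (phi w) (phi w)^-1 + 2 * rho
       < word_length psi (phi w) + word_length psi (phi w)^-1)%N).
    move=> v; rewrite -ij /= /close a'E /x basis_letter_inv.
    rewrite /basis_letter /b !ffunE eqxx; case: a.2; rewrite ?invgK//.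
    by rewrite vertex_distC (addnC (word_length _ (_^-1)%g)).
  move=> l ln; apply: (le_trans (count_self k1 hitsP four (ltn0Sn K) KP (leqnn _) ns Ki0 ln)).
  rewrite -mulrDl ler_wpM2r ?exprn_ge0 ?(ltW q0)// -/Q -/tau ME.
  rewrite mulrDr lerD//.
    by rewrite mulrA natrM -expr2.
  have QS : Q ^+ (rho + e) <= Q ^+ (2 * e) * Q ^+ S.
    rewrite -exprD ler_weXn2l// addnC mul2n -addnn -addnA leq_add2l.
    by rewrite /S mulnDl mul1n addnAC addnA leq_addl.
  rewrite natrM.
  have : (n.+1)%:R * Q ^+ (rho + e) <= (n.+1)%:R ^+ 2 * (Q ^+ (2 * e) * Q ^+ S).
    apply: ler_pM => //; first by rewrite exprn_ge0.
    by rewrite expr2; move: (n.+1%:R : R) n1 => u; nra.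
  move=> /(ler_wpM2r (tn n./2)); move: (Q ^+ (rho + e)) (Q ^+ (2 * e)) (Q ^+ S) => u v w.
  by move: ((n.+1)%:R : R) (tau ^+ _) => N1 y; clear; nra.
have F0 : (0 < #|{ffun 'I_k -> n.-bseq (letter m)}|)%N.
  by apply/card_gt0P; exists [ffun=> [bseq]].
have F1 : 0 < #|{ffun 'I_k -> n.-bseq (letter m)}|%:R :> R by rewrite ltr0n.
apply: (le_trans (@generic_defect R m k n _ bad _ F0)).
  move=> t ndiv; apply/negPn/negP; rewrite negb_or => /andP[/existsPn ns' /existsPn nc].
  apply: ndiv; exists (2 * rho)%N; rewrite /= /tuple_of_ffun.
  have bE i : phi (tnth [tuple (t i : word m) | i < k] i) = b t i by rewrite tnth_mktuple.
  have xE a : basis_letter (fun i => phi (tnth [tuple (t i : word m) | i < k] i)) a = x t a.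
    by rewrite /x /basis_letter !bE.
  split=> [a a' aa'|i].
    rewrite !xE; have /existsPn/(_ a') := nc a; rewrite aa' /= /close -leqNgt.
    by [].
  have := ns' i; rewrite /short -ltnNge bE => /ltnW; apply: leq_trans.
  by rewrite /S; clear; lia.
rewrite ler_pdivrMr//; apply: (le_trans _ (ler_wpM2r (ltW F1) bound)).
have -> : c%:R * (n.+1%:R ^+ 3 * Q ^+ (2 * e) * (tau ^+ i0 + 2 * (Q ^+ S * tau ^+ n./2)))
   = c%:R * ((n.+1)%:R * M) by rewrite ME exprS; ring.
have cb : (#|bad| <= \sum_(i : 'I_k) #|[pred t | short i t]|
    + \sum_(p : letter k * letter k | p.1 != p.2) #|[pred t | close p.1 p.2 t]|)%N.
  have cE (p : pred {ffun 'I_k -> n.-bseq (letter m)}) : #|p| = (\sum_t (p t : nat))%N.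
    by rewrite -sum1_card big_mkcond; apply: eq_bigr => t _; rewrite unfold_in; case: (p t).
  rewrite cE; under [X in (_ <= X + _)%N]eq_bigr do rewrite cE.
  rewrite [X in (_ <= X + _)%N]exchange_big /=.
  under [X in (_ <= _ + X)%N]eq_bigr do rewrite cE; rewrite [X in (_ <= _ + X)%N]exchange_big /=.
  rewrite -big_split /=; apply: leq_sum => t _.
  case bt : (bad t) => //; case/orP: bt => [/existsP[i si]|/existsP[a /existsP[a' /andP[aa' ca]]]].
    by rewrite (bigD1 i)//= si -addnA leq_addr.
  by rewrite [X in (_ <= _ + X)%N](bigD1 (a, a'))//= ca addnCA leq_addr.
apply: (@le_trans _ _ ((\sum_(i : 'I_k) (n.+1)%:R * M * #|{ffun 'I_k -> n.-bseq (letter m)}|%:R)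
   + \sum_(p : letter k * letter k) (n.+1)%:R * M * #|{ffun 'I_k -> n.-bseq (letter m)}|%:R)).
  apply: (@le_trans _ _ _ _ _ (_ : _ <= _%:R)); first by rewrite ler_nat; exact: cb.
  rewrite natrD !natr_sum lerD//; first exact: ler_sum.
  rewrite big_mkcond /=; apply: ler_sum => p _; case: ifP => [|_]; first exact: pairP.
  by rewrite !mulr_ge0.
rewrite !sumr_const !card_prod !card_bool card_ord -mulrnDr -/c -[leLHS]mulr_natl.
by rewrite !mulrA.
Qed.

(** * Conclusion *)

Lemma hyperbolic_four_point (R : realType) (G : groupType) :
  hyperbolic_group R G ->
  exists m (psi : generators m G) D, four_point_bound D psi.
Proof.
move=> [m [psi [delta [geo thin]]]]; exists m, psi.
pose C := 6 * delta + 2; exists (Num.bound `|C|) => x y z w.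
have C1 : C <= (Num.bound `|C|)%:R :> R.
  exact: le_trans (ler_norm _) (ltW (archi_boundP (normr_ge0 _))).
have dE g h : mdist (Vertex g : cayley R psi) (Vertex h) = (vertex_dist psi g h)%:R.
  by rewrite /mdist /= /via_ends /route /= add0r addr0 !minxx.
have := four_point geo thin (Vertex x) (Vertex y) (Vertex z) (Vertex w).
rewrite !dE -!natrD -natr_max => h.
by rewrite -(ler_nat R) [leRHS]natrD (le_trans h)// lerD2l.
Qed.

Lemma identity_words_ge m (G : groupType) (phi : generators m G) n :
  (m.*2 ^ n <= identity_words phi n.*2)%N.
Proof.
have sz (u : n.-tuple (letter m)) : size (u ++ word_inv u) == n.*2.
  by rewrite size_cat size_word_inv size_tuple addnn.
pose f u := Tuple (sz u).
have f_inj : injective f.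
  move=> u v /(congr1 val) /= /(congr1 (take n)).
  by rewrite !take_size_cat ?size_tuple// => /val_inj.
have <- : #|codom f| = (m.*2 ^ n)%N.
  by rewrite card_codom// card_tuple card_prod card_ord card_bool muln2.
apply/subset_leq_card/fintype.subsetP => _ /codomP[u ->]; rewrite unfold_in /=.
by rewrite word_val_cat word_val_inv mulgV.
Qed.

(* When the defining sequence diverges, [gross_cogrowth] is the junk value 0 and
   so is the quotient. *)
Lemma cogrowth_ratio_le1 (R : realType) m (G : groupType) (phi : generators m G) :
  (1 < m)%N -> (1 - gross_cogrowth R phi) / gross_cogrowth R phi <= 1.
Proof.
move=> m1; set theta := gross_cogrowth R phi; pose u n : R := (n.*2)%:R^-1 *
    (ln (identity_words phi n.*2)%:R / ln (m.*2)%:R).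
have [cu|ncu] := pselect (cvgn u); last first.
  by rewrite /theta /gross_cogrowth (dvgP ncu) invr0 mulr0.
have theta_half : 1 / 2 <= theta.
  apply: limr_ge => //; near=> n.
  have n0 : (0 < n)%N by near: n; exact: nbhs_infty_gt.
  have q1 : 1 < (m.*2)%:R :> R by rewrite ltr1n -addnn; lia.
  have lq : 0 < ln (m.*2)%:R :> R by rewrite ln_gt0.
  rewrite /u ler_pdivlMl ?ltr0n ?double_gt0// ler_pdivlMr//.
  have -> : n.*2%:R * (1 / 2) = n%:R :> R by rewrite -muln2 natrM; field.
  have qn : 0 < (m.*2)%:R ^+ n :> R by rewrite exprn_gt0//; lra.
  have le : (m.*2)%:R ^+ n <= (identity_words phi n.*2)%:R :> R.
    by rewrite -natrX ler_nat identity_words_ge.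
  rewrite mulr_natl -lnXn; last by lra.
  by rewrite ler_ln ?posrE// (lt_le_trans qn le).
have t0 : 0 < theta by lra.
by rewrite ler_pdivrMr//; lra.
Unshelve. all: by end_near.
Qed.

Section Conclusion.
Variables (R : realType) (m k : nat) (G : groupType) (phi : generators m G).
Variables (w : k.-tuple (word m)) (M : nat).
Local Notation b := (fun i : 'I_k => phi (tnth w i)).
Hypothesis M0 : (0 < M)%N.
Hypothesis bpos : forall i, (0 < word_length phi (b i))%N.
Hypothesis bP : forall v : word k, reduced v ->
  (M * (\sum_(a <- v) word_length phi (basis_letter b a))
    <= M.+1 * word_length phi (basis_val b v))%N.

Lemma free_of_rank_images : free_of_rank k (generated (images phi w)).
Proof.
exists b; split => // v rv vn bv; have := bP rv.
rewrite bv word_length1 muln0 leqn0 muln_eq0 (gtn_eqF M0)/=.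
case: v vn {rv bv} => // -[i s] v _; rewrite big_cons addn_eq0 => /andP[+ _].
by rewrite /basis_letter /=; case: s; rewrite ?word_lengthV gtn_eqF.
Qed.

(** A reduced expression of [h] bounds [sub_length] from above, so the ratio is at least
    [M / M.+1 = 1 - 1 / M.+1]. The lower bound by [word_length phi h] keeps the denominator
    positive. *)
Lemma compression_images (eps : R) : 1 <= eps * (M.+1)%:R ->
  ((1 - eps)%:E <= compression R phi (generated (images phi w)) (sym_images phi w))%E.
Proof.
move=> epsM; apply/ereal_infP => _ [h [gh h1] <-]; rewrite lee_fin.
have [v rv vh] := generated_reduced gh.
have [subge sub] : (word_length phi h <= sub_length phi (sym_images phi w) h)%N /\
    (sub_length phi (sym_images phi w) h
      <= \sum_(a <- v) word_length phi (basis_letter b a))%N.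
  rewrite /sub_length; set A := [set _ | _ in _].
  have Av : A (\sum_(a <- v) word_length phi (basis_letter b a))%N.
    exists [seq basis_letter b a | a <- v]; last by rewrite big_map.
    split=> [x /mapP[[i s] _ ->]|]; last by rewrite big_map.
    rewrite /basis_letter /=; case: s; [right|left]; last by exists i.
    by exists (phi (tnth w i)) => //; exists i.
  have [[s [_ <-] <-] minA] := @nat_minP A (ex_intro _ _ Av).
  split; last exact: minA.
  elim: s {minA} => [|x s IH]; first by rewrite !big_nil word_length1.
  by rewrite !big_cons (leq_trans (word_lengthM _ _ _))// leq_add2l.
have := bP rv; rewrite vh => le.
have hpos : (0 < word_length phi h)%N.
  by rewrite lt0n; apply/eqP => /word_length_eq0.
rewrite ler_pdivlMr ?ltr0n ?(leq_trans hpos subge)//.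
have : M%:R * (sub_length phi (sym_images phi w) h)%:R
    <= (M.+1)%:R * (word_length phi h)%:R :> R.
  by rewrite -!natrM ler_nat (leq_trans _ le)// leq_mul2l sub orbT.
have : 0 <= (sub_length phi (sym_images phi w) h)%:R :> R by [].
have : 0 < (M.+1)%:R :> R by rewrite ltr0n.
move: epsM; rewrite -natr1.
move: (M%:R : R) (sub_length phi (sym_images phi w) h)%:R (word_length phi h)%:R.
move=> x y z epsx x0 y0 xyz; rewrite -(ler_pM2l x0); nra.
Qed.

End Conclusion.

Theorem theorem2p1 (R : realType) (G : groupType) (m k : nat)
    (phi : generators m G) :
  (1 < m)%N -> (0 < k)%N ->
  hyperbolic_group R G -> ~ elementary G ->
  exp_generic R
    [set w : k.-tuple (word m) | free_of_rank k (generated (images phi w))] /\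
  forall eps : R, 0 < eps ->
    let theta := gross_cogrowth R phi in
    exp_generic R
      [set w : k.-tuple (word m) |
        (((1 - theta) / theta - eps)%:E
          <= compression R phi (generated (images phi w))
               (sym_images phi w))%E].
Proof.
move=> m1 k0 hyp nel; have [m' [psi [D four]]] := hyperbolic_four_point hyp.
split=> [|eps eps0 theta].
  (* For freeness it is enough that nonempty reduced words have positive length, so [M = 1] will
     do. *)
  have [A [B AB]] := chain_length phi 1 four.
  apply: (exp_generic_sub _ (diverging_generic R phi A B k m1 four nel)) => w [r [div long]].
  have [bpos bP] := AB k _ r div long.
  exact: (free_of_rank_images (isT : 0 < 1)%N bpos bP).
pose M := Num.bound eps^-1.
have epsM : 1 <= eps * (M.+2)%:R.
  have h : eps^-1 <= M%:R by apply/ltW/archi_boundP; rewrite invr_ge0 ltW.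
  have : eps * eps^-1 <= eps * M%:R by rewrite ler_wpM2l// ltW.
  rewrite divff ?gt_eqF// => /le_trans; apply; rewrite ler_wpM2l ?(ltW eps0)//.
  by rewrite ler_nat -addn2 leq_addr.
have [A [B AB]] := chain_length phi M.+1 four.
apply: (exp_generic_sub _ (diverging_generic R phi A B k m1 four nel)) => w [r [div long]].
have [bpos bP] := AB k _ r div long.
have := compression_images bP epsM; apply: le_trans.
by rewrite lee_fin lerB// cogrowth_ratio_le1.
Qed.
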